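(* Let $\mu$ be a pairwise-connected distribution on $\Sigma\times\Gamma\times\Phi$ (finite sets) and let $T:\mathsf{supp}(\mu)\to\mathbb{D}$ be nonembeddable over $\mathbb{D}$. Then there is a constant $c=c(T,\mu)>0$ such that for all $n$ and all functions $F:\Sigma^n\to\mathbb{D}$, $G:\Gamma^n\to\mathbb{D}$, $H:\Phi^n\to\mathbb{D}$, $$\left|\mathbb{E}_{(x,y,z)\sim\mu^{\otimes n}}\Big[F(x)G(y)H(z)\prod_{i=1}^nT(x_i,y_i,z_i)\Big]\right|\le 2^{-cn}.$$
   Context: $\mathbb{D}$ is the closed unit disk in $\mathbb{C}$. $T$ is nonembeddable over $\mathbb{D}$ if there are no functions $A:\Sigma\to\mathbb{D}$, $B:\Gamma\to\mathbb{D}$, $C:\Phi\to\mathbb{D}$ with $A(x)B(y)C(z)T(x,y,z)=1$ for all $(x,y,z)\in\mathsf{supp}(\mu)$. $\mu$ is pairwise-connected if each of the three bipartite graphs (on $\Sigma\sqcup\Gamma$, $\Gamma\sqcup\Phi$, $\Sigma\sqcup\Phi$), where two symbols from different coordinates are adjacent iff they appear together in some triple of $\mathsf{supp}(\mu)$, is connected. *)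

(* Defs.v *)
From HB Require Import structures.
From mathcomp Require Import all_boot all_order all_algebra.
From mathcomp Require Import reals exp.
From mathcomp Require Import complex.
Set Implicit Arguments. Unset Strict Implicit. Unset Printing Implicit Defensive.
Import Order.TTheory GRing.Theory Num.Theory.
Local Open Scope ring_scope.
Local Open Scope complex_scope.

Definition inD (R : realType) (z : R[i]) : bool := `|z| <= 1.

Section Defs.
Variables (R : realType) (S G P : finType).

Definition is_distribution (mu : S -> G -> P -> R) : Prop :=
  (forall x y z, 0 <= mu x y z) /\
  \sum_(x : S) \sum_(y : G) \sum_(z : P) mu x y z = 1.

Definition in_supp (mu : S -> G -> P -> R) x y z : bool := 0 < mu x y z.

Definition bip_connected (A B : finType) (adj : A -> B -> bool) : Prop :=
  let e : rel (A + B) := fun u v =>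
    match u, v with
    | inl a, inr b => adj a b
    | inr b, inl a => adj a b
    | _, _ => false
    end in
  forall u v, connect e u v.

Definition pairwise_connected (mu : S -> G -> P -> R) : Prop :=
  bip_connected (fun (x : S) (y : G) => [exists z, in_supp mu x y z]) /\
  bip_connected (fun (y : G) (z : P) => [exists x, in_supp mu x y z]) /\
  bip_connected (fun (x : S) (z : P) => [exists y, in_supp mu x y z]).

(* T : supp(mu) -> D, represented as a total function whose values on
   supp(mu) lie in D (values outside supp(mu) are irrelevant). *)
Definition maps_supp_to_D (mu : S -> G -> P -> R) (T : S -> G -> P -> R[i]) :=
  forall x y z, in_supp mu x y z -> inD (T x y z).

Definition nonembeddable (mu : S -> G -> P -> R) (T : S -> G -> P -> R[i]) :=
  ~ exists (A : S -> R[i]) (B : G -> R[i]) (C : P -> R[i]),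
      (forall x, inD (A x)) /\ (forall y, inD (B y)) /\ (forall z, inD (C z)) /\
      (forall x y z, in_supp mu x y z -> A x * B y * C z * T x y z = 1).

Definition corr (mu : S -> G -> P -> R) (T : S -> G -> P -> R[i]) (n : nat)
  (F : {ffun 'I_n -> S} -> R[i]) (Gf : {ffun 'I_n -> G} -> R[i])
  (H : {ffun 'I_n -> P} -> R[i]) : R[i] :=
  \sum_(x : {ffun 'I_n -> S}) \sum_(y : {ffun 'I_n -> G}) \sum_(z : {ffun 'I_n -> P})
    (\prod_(i < n) mu (x i) (y i) (z i))%:C *
    (F x * Gf y * H z * \prod_(i < n) T (x i) (y i) (z i)).
End Defs.

(* Main.v *)
(* If |T| < 1 somewhere on the support, the triangle inequality already gives decay, so let |T| = 1.
   Consider finite systems of configurations carrying a weight, a phase and several "wires"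
   (letters read by independent bounded functions); at first a configuration is a point (x, y, z)
   with wires x, y, z and phase T.  By Cauchy-Schwarz, if gluing two copies of a system along some
   of its wires yields a decaying system, the system itself decays.  A system all of whose wires have
   been glued decays as soon as two of its phases differ.  Hence, if T does not decay, the phase of a
   configuration is a function of its open wires in every system obtained by gluing.

   Gluing along x and z produces paths joining any two z-letters.  Two such paths, prolonged by one
   point each and glued along a common y, are then glued to a second such pair along the y-letters of
   the paths, and this is iterated.  The resulting system can move a pair (z, x) to (z', x') at the
   cost T(x, y, z) / T(x', y, z'), and can also exchange the z-letters of two pairs at no cost.
   Splicing copies of it gives systems acting on words of arbitrary length.  So any closed walk in the
   graph of x-letters sharing a y-letter, along which the z-letters consumed and produced agree up to
   order, has total phase 1: the phase of a closed walk is a character of its z-content.  The unit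
   circle is divisible, so this character extends to the free abelian group on the z-letters and gives
   the factor in z; after dividing by it, the phase of a walk depends on its endpoints only, which
   gives the factors in x and y. *)
Require Import Defs.
From HB Require Import structures.
From mathcomp Require Import all_boot all_order all_algebra.
From mathcomp Require Import boolp reals exp.
From mathcomp Require Import complex.
From mathcomp Require Import ring.
Set Implicit Arguments. Unset Strict Implicit. Unset Printing Implicit Defensive.
Import Order.TTheory GRing.Theory Num.Theory.
Local Open Scope ring_scope.

(** * Gluing systems by the Cauchy-Schwarz inequality *)

Section Fibers.
Variable L : numClosedFieldType.

(** [Psi] is constant on the fibers of [r], so it comes out of each fiber sum and is bounded by 1.
    The right-hand side is the sum over fibers of |g|^2 / N, with N the mass of the fiber and g the
    weighted sum of [h] over it. *)
Lemma conditional_cauchy_schwarz (X Y : finType) (W Psi h : X -> L) (r : X -> Y) :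
  (forall x, 0 <= W x) -> \sum_x W x = 1 ->
  (forall x, `|Psi x| <= 1) -> (forall x x', r x = r x' -> Psi x = Psi x') ->
  `|\sum_x W x * Psi x * h x| ^+ 2 <=
  \sum_x \sum_(x' | r x' == r x)
     W x * W x' / (\sum_(u | r u == r x) W u) * (h x * (h x')^*).
Proof.
move=> W0 W1 Psi1 Psir.
pose g y := \sum_(x | r x == y) W x * h x.
pose N y := \sum_(x | r x == y) W x.
have N0 y : 0 <= N y by apply: sumr_ge0.
have N1 : \sum_y N y = 1 by rewrite -W1 (partition_big r predT).
have gN y : N y = 0 -> g y = 0.
  move=> /eqP; rewrite psumr_eq0 // => /allP Ny0.
  apply: big1 => x xy; have := Ny0 x; rewrite mem_index_enum xy => /(_ isT).
  by move=> /eqP ->; rewrite mul0r.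
have -> : \sum_x \sum_(x' | r x' == r x)
     W x * W x' / (\sum_(u | r u == r x) W u) * (h x * (h x')^*) =
   \sum_y `|g y| ^+ 2 / N y.
  rewrite (partition_big r predT) //=; apply: eq_bigr => y _.
  rewrite normCK /g rmorph_sum /= !mulr_suml; apply: eq_bigr => x /eqP <-.
  rewrite mulr_sumr mulr_suml; apply: eq_bigr => x' _.
  rewrite rmorphM /= (conj_Creal (ger0_real (W0 x'))) -/(N (r x)).
  by ring.
have le1 : `|\sum_x W x * Psi x * h x| <= \sum_y `|g y|.
  rewrite (partition_big r predT) //=; apply: le_trans (ler_norm_sum _ _ _) _.
  apply: ler_sum => y _.
  case: (pickP (fun x => r x == y)) => [x0 /eqP x0y|noy]; last first.
    by rewrite big_pred0 // normr0.
  have -> : \sum_(x | r x == y) W x * Psi x * h x = Psi x0 * g y.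
    rewrite mulr_sumr; apply: eq_bigr => x /eqP xy.
    by rewrite (Psir x x0) ?xy // mulrCA mulrA mulrAC.
  by rewrite normrM ler_piMl.
set s := \sum_y `|g y|.
apply: le_trans (_ : s ^+ 2 <= _).
  by rewrite lerXn2r ?nnegrE // /s; apply: sumr_ge0.
have s0 : 0 <= s by apply: sumr_ge0.
(* Cauchy-Schwarz in variance form: as the masses add up to 1, expanding leaves the sum of |g|^2 / N
   minus [s] squared. In a null fiber [g] vanishes and division by 0 gives 0. *)
have : 0 <= \sum_y N y * (`|g y| / N y - s) ^+ 2.
  apply: sumr_ge0 => y _; apply: mulr_ge0 => //; apply: real_exprn_even_ge0 => //.
  by rewrite rpredB ?realM ?realV ?ger0_real.
have -> : \sum_y N y * (`|g y| / N y - s) ^+ 2 =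
   \sum_y (`|g y| ^+ 2 / N y - `|g y| * (s *+ 2) + N y * s ^+ 2).
  apply: eq_bigr => y _; have [Ny|Ny] := eqVneq (N y) 0.
    by rewrite Ny gN // normr0 expr0n /= !mul0r subrr addr0.
  by field.
rewrite big_split /= sumrB -!mulr_suml N1 mul1r -/s.
by rewrite -mulr_natr mulrA -expr2 mulr_natr mulr2n opprD -addrA -addrA addNr addr0 subr_ge0.
Qed.
End Fibers.

(** * Systems, decay and gluing *)

Section Systems.
Variable L : numClosedFieldType.

Record system := System {
  cfg : finType;
  wt : cfg -> L;
  phase : cfg -> L;
  wt_ge0 : forall c, 0 <= wt c;
  wt_sum : \sum_c wt c = 1;
  phase_norm : forall c, `|phase c| = 1 }.

(* E relates two configurations showing the same letter on a wire; f is a function of that letter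
   in each of n coordinates. *)
Definition local_fun (C : finType) n (E : C -> C -> Prop) (f : {ffun 'I_n -> C} -> L) :=
  (forall c, `|f c| <= 1) /\
  (forall c c' : {ffun 'I_n -> C}, (forall k, E (c k) (c' k)) -> f c = f c').

Definition decays (S : system) (I : finType) (E : I -> cfg S -> cfg S -> Prop) :=
  exists rho : L, 0 < rho < 1 /\
    forall n (f : I -> {ffun 'I_n -> cfg S} -> L), (forall i, local_fun (E i) (f i)) ->
    `|\sum_(c : {ffun 'I_n -> cfg S})
        (\prod_k (wt (c k) * phase (c k))) * \prod_i f i c| <= rho ^+ n.

Section Glue.
Variables (S : system) (T : eqType) (key : cfg S -> T).

Definition fiber_wt c := \sum_(d | key d == key c) wt d.

(** The coupling of two copies that are conditionally independent given a common key; both marginals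
    are [wt]. *)
Definition glue_wt (c : cfg S * cfg S) :=
  if key c.2 == key c.1 then wt c.1 * wt c.2 / fiber_wt c.1 else 0.

Lemma fiber_wt_ge0 c : 0 <= fiber_wt c.
Proof. by apply: sumr_ge0 => d _; apply: wt_ge0. Qed.

Lemma fiber_wt_gt0 c : 0 < wt c -> 0 < fiber_wt c.
Proof.
move=> c0; rewrite /fiber_wt (bigD1 c) //=; apply: ltr_pwDl => //.
by apply: sumr_ge0 => d _; apply: wt_ge0.
Qed.

Lemma glue_wt_ge0 c : 0 <= glue_wt c.
Proof.
rewrite /glue_wt; case: ifP => // _.
by rewrite mulr_ge0 ?invr_ge0 ?fiber_wt_ge0 // mulr_ge0 ?wt_ge0.
Qed.

Lemma glue_wt_sum : \sum_c glue_wt c = 1.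
Proof.
rewrite -(pair_bigA _ (fun a b => glue_wt (a, b))) /= -(wt_sum S).
apply: eq_bigr => a _; rewrite /glue_wt /= -big_mkcond /=.
have [a0|a0] := eqVneq (wt a) 0.
  by rewrite a0; apply: big1 => b _; rewrite !mul0r.
rewrite -mulr_suml -mulr_sumr -/(fiber_wt a) mulfK // gt_eqF // fiber_wt_gt0 //.
by rewrite lt_neqAle eq_sym a0 wt_ge0.
Qed.

Lemma glue_phase_norm (c : cfg S * cfg S) : `|phase c.1 / phase c.2| = 1.
Proof. by rewrite normrM normfV !phase_norm divr1. Qed.

Definition glue := System glue_wt_ge0 glue_wt_sum glue_phase_norm.

Lemma glue_wt_gt0 a b : 0 < wt a -> 0 < wt b -> key a = key b -> 0 < wt ((a, b) : cfg glue).
Proof.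
move=> a0 b0 kab; rewrite /= /glue_wt /= kab eqxx.
by rewrite mulr_gt0 ?invr_gt0 ?fiber_wt_gt0 // mulr_gt0.
Qed.

(* Bound the functions of the wires in g, which depend on the key only, by 1 and apply
   Cauchy-Schwarz over the fibers of the key; the remaining wires appear once in each copy, and pi1,
   pi2 say which wire of the glued system each of the two is merged into. *)
Lemma decays_glue (I I' : finType) (E : I -> cfg S -> cfg S -> Prop)
    (E' : I' -> cfg glue -> cfg glue -> Prop) (g : pred I) (pi1 pi2 : I -> I') :
  (forall i a a', g i -> key a = key a' -> E i a a') ->
  (forall i a b a' b', ~~ g i -> E' (pi1 i) (a, b) (a', b') -> E i a a') ->
  (forall i a b a' b', ~~ g i -> E' (pi2 i) (a, b) (a', b') -> E i b b') ->
  decays E' -> decays E.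
Proof.
move=> Eg E1 E2 [rho [/andP[rho0 rho1] decE']].
exists (sqrtC rho); split.
  by rewrite sqrtC_gt0 rho0 /= -[X in _ < X]sqrtC1 ltr_sqrtC ?nnegrE ?ler01 // ltW.
move=> n f fE.
rewrite -(@ler_pXn2r _ 2) ?nnegrE //; last by rewrite exprn_ge0 // sqrtC_ge0 ltW.
rewrite -exprM mulnC exprM sqrtCK.
(* A representative of each key replaces the key, whose type need not be finite. *)
pose rep c := odflt c [pick d | key d == key c].
have repP c d : (rep c == rep d) = (key c == key d).
  have keyrep u : key (rep u) = key u.
    by rewrite /rep; case: pickP => [v /eqP|/(_ u)]; rewrite ?eqxx.
  apply/eqP/eqP => [e|e]; first by rewrite -(keyrep c) -(keyrep d) e.
  by rewrite /rep e; case: pickP => // /(_ d); rewrite eqxx.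
pose X := {ffun 'I_n -> cfg S}.
pose W (c : X) := \prod_k wt (c k).
pose Psi (c : X) := \prod_(i | g i) f i c.
pose h (c : X) := (\prod_k phase (c k)) * \prod_(i | ~~ g i) f i c.
pose r (c : X) : X := [ffun k => rep (c k)].
have rE (c d : X) : (r c == r d) = [forall k, key (c k) == key (d k)].
  apply/eqP/forallP => [e k|e].
    by rewrite -repP; have := congr1 (fun u : X => u k) e; rewrite !ffunE => ->.
  by apply/ffunP => k; rewrite !ffunE; apply/eqP; rewrite repP.
have W0 c : 0 <= W c by apply: prodr_ge0 => k _; apply: wt_ge0.
have W1 : \sum_c W c = 1.
  rewrite -(bigA_distr_bigA (fun k c => wt c)) /=.
  by apply: big1 => k _; apply: wt_sum.
have Psi1 c : `|Psi c| <= 1.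
  rewrite normr_prod; apply: prodr_ile1 => i _.
  by rewrite normr_ge0 /=; case: (fE i) => ->.
have Psir c c' : r c = r c' -> Psi c = Psi c'.
  move=> /eqP; rewrite rE => /forallP e; apply: eq_bigr => i gi.
  by case: (fE i) => _; apply=> k; apply: Eg => //; apply/eqP.
have NE c : \sum_(u | r u == r c) W u = \prod_k fiber_wt (c k).
  rewrite (bigA_distr_big_dep (fun k d => key d == key (c k)) (fun _ d => wt d)) /=.
  apply: eq_bigl => u; rewrite rE; apply/forallP/familyP => e k; exact: e.
have CS := conditional_cauchy_schwarz h W0 W1 Psi1 Psir.
move: (CS); have -> : \sum_x W x * Psi x * h x =
  \sum_(c : X) (\prod_k (wt (c k) * phase (c k))) * \prod_i f i c.
  apply: eq_bigr => c _; rewrite big_split /= -/(W c) /h /Psi.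
  rewrite [in RHS](bigID g) /=; ring.
move/le_trans; apply.
pose f1 i (c : {ffun 'I_n -> cfg glue}) := f i [ffun k => (c k).1].
pose f2 i (c : {ffun 'I_n -> cfg glue}) := (f i [ffun k => (c k).2])^*.
pose f' i' (c : {ffun 'I_n -> cfg glue}) :=
  (\prod_(i | ~~ g i && (pi1 i == i')) f1 i c) *
  (\prod_(i | ~~ g i && (pi2 i == i')) f2 i c).
have f'E i' : local_fun (E' i') (f' i').
  split=> [c|c c' e].
    rewrite normrM !normr_prod mulr_ile1 ?prodr_ge0 //; apply: prodr_ile1 => i _.
      by rewrite normr_ge0; case: (fE i) => ->.
    by rewrite norm_conjC normr_ge0; case: (fE i) => ->.
  congr (_ * _); apply: eq_bigr => i /andP[gi /eqP ii'].
    rewrite /f1; case: (fE i) => _; apply=> k; move: (e k); rewrite -ii' !ffunE.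
    by case: (c k) (c' k) => a b [a' b']; apply: E1.
  rewrite /f2; congr (_^*); case: (fE i) => _; apply=> k; move: (e k); rewrite -ii' !ffunE.
  by case: (c k) (c' k) => a b [a' b']; apply: E2.
suff e : \sum_(c : {ffun 'I_n -> cfg glue})
    (\prod_k (wt (c k) * phase (c k))) * \prod_i f' i c =
  \sum_x \sum_(x' | r x' == r x)
    W x * W x' / (\sum_(u | r u == r x) W u) * (h x * (h x')^*).
  (* By [CS] the sum is at least a square, hence real and at most its norm. *)
  rewrite -e; apply: le_trans (decE' n f' f'E); apply: real_ler_norm.
  by apply: ger0_real; rewrite e; apply: le_trans CS; rewrite exprn_ge0.
pose pr (c : X * X) : {ffun 'I_n -> cfg glue} := [ffun k => (c.1 k, c.2 k)].
rewrite (reindex pr); last first.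
  exists (fun c : {ffun 'I_n -> cfg glue} =>
    ([ffun k => (c k).1] : X, [ffun k => (c k).2] : X)) => [[a b] _|c _].
    by congr (_, _); apply/ffunP => k; rewrite !ffunE.
  by apply/ffunP => k; rewrite !ffunE; case: (c k).
rewrite -(pair_bigA _ (fun a b => (\prod_k (wt (pr (a, b) k) * phase (pr (a, b) k))) *
  \prod_i f' i (pr (a, b)))) /=.
apply: eq_bigr => a _; rewrite [RHS]big_mkcond /=; apply: eq_bigr => b _.
rewrite NE.
have -> : \prod_i f' i (pr (a, b)) =
    \prod_(i | ~~ g i) f i a * (\prod_(i | ~~ g i) f i b)^*.
  rewrite big_split /= rmorph_prod /=.
  rewrite [in RHS](partition_big pi1 predT) //= [X in _ = _ * X](partition_big pi2 predT) //=.
  congr (_ * _); apply: eq_bigr => i' _; apply: eq_bigr => i _.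
    by congr (f i _); apply/ffunP => k; rewrite !ffunE.
  by congr ((f i _)^*); apply/ffunP => k; rewrite !ffunE.
rewrite rE; case: ifP => [/forallP kab|/forallP kab].
  have -> : \prod_k (wt (pr (a, b) k) * phase (pr (a, b) k)) =
    (W a * W b / \prod_k fiber_wt (a k)) * ((\prod_k phase (a k)) * (\prod_k phase (b k))^*).
    rewrite -prodfV rmorph_prod /= -!big_split /=; apply: eq_bigr => k _.
    rewrite ffunE /= /glue_wt /= kab; congr (_ * (_ * _)).
    by rewrite invC_norm phase_norm expr1n invr1 mul1r.
  rewrite /h rmorphM /=; ring.
(* One coordinate with different keys makes the glued weight vanish. *)
have [k kk] : exists k, key (b k) != key (a k).
  by apply/existsP; rewrite -negb_forall; apply/negP => /forallP.
rewrite (bigD1 k) //= ffunE /= /glue_wt /= (negbTE kk); by rewrite !mul0r.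
Qed.
End Glue.
End Systems.

(** * Non-decaying systems and their phases *)

Section Nondecaying.
Variable L : numClosedFieldType.
Implicit Types S : system L.

(** The wire shows nothing, so its function is constant and the sum is that constant times the n-th
    power of the mean phase [s]. Equality in the triangle inequality would force a single phase on
    positive weight. *)
Lemma decays_of_two_phases S c1 c2 : 0 < @wt L S c1 -> 0 < @wt L S c2 ->
  phase c1 != phase c2 -> @decays L S unit (fun _ _ _ => True).
Proof.
move=> c1p c2p; pose s : L := \sum_(c : cfg S) wt c * phase c => c12.
have F1 (c : cfg S) : `|wt c * phase c| = wt c.
  by rewrite normrM phase_norm mulr1 ger0_norm // wt_ge0.
have s1 : `|s| < 1.
  rewrite lt_neqAle; apply/andP; split; last first.
    by apply: le_trans (ler_norm_sum _ _ _) _; rewrite (eq_bigr _ (fun c _ => F1 c)) wt_sum.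
  apply: contra c12 => /eqP sE.
  have : `|\sum_(c : cfg S) wt c * phase c| = \sum_(c : cfg S) `|wt c * phase c|.
    by rewrite (eq_bigr _ (fun c _ => F1 c)) wt_sum.
  case/normC_sum_eq => t _ tE.
  suff ph (c : cfg S) : 0 < wt c -> phase c = t by rewrite !ph.
  move=> cp; have := tE c isT; rewrite F1; apply: mulfI.
  by rewrite gt_eqF.
(* Not |s| itself, which may be 0, while the rate has to be positive. *)
exists ((1 + `|s|) / 2); split.
  rewrite divr_gt0 ?ltr_wpDr ?ltr01 ?ltr0n //= ltr_pdivrMr ?ltr0n // mul1r.
  by rewrite -[2]/(1 + 1) ltrD2l.
move=> n f fE; pose c0 : {ffun 'I_n -> cfg S} := [ffun _ => c1].
rewrite (eq_bigr (fun c : {ffun 'I_n -> cfg S} =>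
  (\prod_k (wt (c k) * phase (c k))) * f tt c0)); last first.
  move=> c _; congr (_ * _); rewrite (big_pred1 tt) => [|[]//].
  by case: (fE tt) => _; apply.
rewrite -mulr_suml -(bigA_distr_bigA (fun _ (c : cfg S) => wt c * phase c)) /= prodr_const card_ord.
rewrite -/s normrM normrX; apply: le_trans (_ : `|s| ^+ n <= _).
  by rewrite ler_piMr ?exprn_ge0 //; case: (fE tt).
rewrite lerXn2r ?nnegrE ?divr_ge0 ?addr_ge0 ?ler0n ?ler01 // ler_pdivlMr ?ltr0n //.
by rewrite mulr_natr mulr2n lerD2r ltW.
Qed.

(* A non-decaying system observed through b; only some of the (boundary, phase) pairs that occur in
   it with positive weight are recorded in Q. *)
Definition nd (B : Type) (I : finType) (E : I -> B -> B -> Prop) (Q : B -> L -> Prop) :=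
  exists S (b : cfg S -> B), ~ decays (fun i c c' => E i (b c) (b c')) /\
    forall v t, Q v t -> exists c, [/\ 0 < wt c, b c = v & phase c = t].

Lemma nd_norm B (I : finType) (E : I -> B -> B -> Prop) Q v t : nd E Q -> Q v t -> `|t| = 1.
Proof. by move=> [S [b [_ Qb]]] /Qb [c [_ _ <-]]; exact: phase_norm. Qed.

(** The contrapositive of [decays_glue], with [m] computing the boundary of a glued pair. *)
Lemma nd_glue (B B' : Type) (T : eqType) (key : B -> T) (m : B -> B -> B')
    (I I' : finType) (E : I -> B -> B -> Prop) (E' : I' -> B' -> B' -> Prop)
    (g : pred I) (pi1 pi2 : I -> I') (Q : B -> L -> Prop) (Q' : B' -> L -> Prop) :
  (forall i a a', g i -> key a = key a' -> E i a a') ->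
  (forall i a b a' b', ~~ g i -> E' (pi1 i) (m a b) (m a' b') -> E i a a') ->
  (forall i a b a' b', ~~ g i -> E' (pi2 i) (m a b) (m a' b') -> E i b b') ->
  (forall v t, Q' v t -> exists a b s u,
     [/\ Q a s, Q b u, key a = key b, v = m a b & t = s / u]) ->
  nd E Q -> nd E' Q'.
Proof.
move=> Eg E1 E2 Q'Q [S [b [dec Qb]]].
exists (glue (fun c : cfg S => key (b c))), (fun c => m (b c.1) (b c.2)); split.
  apply: contra_not dec; apply: (decays_glue (g := g) (pi1 := pi1) (pi2 := pi2)).
  - by move=> i a a' /Eg; apply.
  - by move=> i a a' c c' gi /=; apply: E1.
  - by move=> i a a' c c' gi /=; apply: E2.
move=> v t /Q'Q [a [a' [s [u [/Qb [c [c0 <- <-]] /Qb [c' [c'0 <- <-]] k -> ->]]]]].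
by exists (c, c'); split=> //; apply: glue_wt_gt0.
Qed.

(* Otherwise gluing along the whole boundary gives a system with two different phases. *)
Lemma nd_phase_uniq (B : eqType) (I : finType) (E : I -> B -> B -> Prop) Q v t t' :
  (forall i a, E i a a) -> nd E Q -> Q v t -> Q v t' -> t = t'.
Proof.
move=> Erefl [S [b [dec Qb]]] /Qb [c [c0 bc <-]] /Qb [c' [c'0 bc' <-]].
apply/eqP; apply: contra_notT dec => cc'.
apply: (decays_glue (key := b) (g := predT) (pi1 := fun _ => tt) (pi2 := fun _ => tt)
  (E' := fun _ _ _ => True)) => //.
  by move=> i a a' _ ->.
(* The diagonal pair has phase 1, the mixed pair the quotient of the two phases. *)
apply: (decays_of_two_phases (S := glue b) (c1 := (c, c)) (c2 := (c, c'))).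
- exact: glue_wt_gt0.
- by apply: glue_wt_gt0 => //; rewrite bc bc'.
have nz (d : cfg S) : phase d != 0 by rewrite -normr_eq0 phase_norm oner_eq0.
rewrite /= divff //; apply: contra cc' => /eqP e.
by apply/eqP; rewrite -[LHS](divfK (nz c')) -e mul1r.
Qed.

End Nondecaying.

Definition wires3 (A B D : Type) (i : option bool) (v w : A * B * D) : Prop :=
  match i with
  | Some true => v.1.1 = w.1.1
  | Some false => v.1.2 = w.1.2
  | None => v.2 = w.2
  end.

Definition wires4 (A B : Type) (i : bool * bool) (v w : (A * B) * (A * B)) : Prop :=
  match i with
  | (true, true) => v.1.1 = w.1.1
  | (true, false) => v.1.2 = w.1.2
  | (false, true) => v.2.1 = w.2.1
  | (false, false) => v.2.2 = w.2.2
  end.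

(** * Chains of configurations *)

Section Chain.
Variables (L : numClosedFieldType) (A B D : eqType).
Variable Q : A * B * D -> L -> Prop.

(** Height 0 glues along the letter in [D], each further height along the second ends. A chain read
    backwards has inverse phase, so every height joins two chains end to end. *)
Fixpoint chain k (v : (A * B) * (A * B)) (t : L) : Prop :=
  match k with
  | 0 => exists d s u, [/\ Q (v.1, d) s, Q (v.2, d) u & t = s / u]
  | k'.+1 => exists e s u, [/\ chain k' (v.1, e) s, chain k' (v.2, e) u & t = s / u]
  end.

Lemma nd_chain k : nd (@wires3 A B D) Q -> nd (@wires4 A B) (chain k).
Proof.
move=> ndQ; elim: k => [|k].
  apply: (nd_glue (key := fun v => v.2) (m := fun v w => (v.1, w.1))
    (g := fun i => i == None) (pi1 := fun i => (true, odflt true i))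
    (pi2 := fun i => (false, odflt true i))) ndQ.
  - by move=> [[]|].
  - by move=> [[]|].
  - by move=> [[]|].
  move=> [e e'] t [d [s [u [Qs Qu ->]]]].
  by exists (e, d), (e', d), s, u.
apply: (nd_glue (key := fun v => v.2) (m := fun v w => (v.1, w.1))
  (g := fun i => ~~ i.1) (pi1 := fun i => (true, i.2)) (pi2 := fun i => (false, i.2))).
- by move=> [[] []] //= [a a'] [c c'] _ /= ->.
- by move=> [[] []].
- by move=> [[] []].
move=> [e e'] t [d [s [u [Qs Qu ->]]]].
by exists (e, d), (e', d), s, u.
Qed.

Hypothesis Q_neq0 : forall v t, Q v t -> t != 0.

Lemma chain_sym k e e' t : chain k (e, e') t -> chain k (e', e) t^-1.
Proof.
by case: k => [|k] [d [s [u [Qs Qu ->]]]]; exists d, u, s; rewrite invfM invrK mulrC.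
Qed.

Definition inhabited_at e := exists d s, Q (e, d) s.

Lemma chain_inhabited k e e' t : chain k (e, e') t -> inhabited_at e /\ inhabited_at e'.
Proof.
elim: k e e' t => [|k IH] e e' t [d [s [u [Qs Qu _]]]].
  by split; exists d; eexists; eassumption.
by have [? _] := IH _ _ _ Qs; have [? _] := IH _ _ _ Qu.
Qed.

Lemma chain_refl k e : inhabited_at e -> chain k (e, e) 1.
Proof.
elim: k => [|k IH] /=.
  by move=> [d [s Qs]]; exists d, s, s; rewrite divff // (Q_neq0 Qs).
by move=> /IH ek; exists e, 1, 1; rewrite divr1.
Qed.

Lemma chain_weaken k e e' t : chain k (e, e') t -> chain k.+1 (e, e') t.
Proof.
move=> c; have [_ e'i] := chain_inhabited c.
by exists e', t, 1; rewrite divr1; split=> //; apply: chain_refl.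
Qed.

Lemma chain_leq k k' e e' t : (k <= k')%N -> chain k (e, e') t -> chain k' (e, e') t.
Proof.
move=> /subnKC <- c; elim: (_ - _)%N => [|j IH]; rewrite ?addn0 // addnS.
exact: chain_weaken.
Qed.

Definition linked e e' t := exists k, chain k (e, e') t.

(** Both chains are raised to a common height by trivial chains, and the second is reversed before
    gluing. *)
Lemma linked_trans e e' e'' t t' :
  linked e e' t -> linked e' e'' t' -> linked e e'' (t * t').
Proof.
move=> [k c] [k' c']; exists (maxn k k').+1, e', t, t'^-1; rewrite invrK; split=> //.
  exact: chain_leq (leq_maxl _ _) c.
exact/chain_sym/(chain_leq (leq_maxr _ _) c').
Qed.

Lemma linked_shared e e' d s u : Q (e, d) s -> Q (e', d) u -> linked e e' (s / u).
Proof. by move=> Qs Qu; exists 0, d, s, u. Qed.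

Lemma linked_closed e t : nd (@wires3 A B D) Q -> linked e e t -> t = 1.
Proof.
move=> ndQ [k c]; have [ei _] := chain_inhabited c.
apply: (nd_phase_uniq _ (nd_chain k ndQ) c); last exact: chain_refl.
by move=> [[] []].
Qed.

End Chain.

(** * Merging wires, and permutations from exchanges *)

Section Coarsen.
Variable L : numClosedFieldType.

(** The functions of all wires merged into [i'] multiply to one bounded function of that wire. *)
Lemma decays_coarsen (S : system L) (I I' : finType) (E : I -> cfg S -> cfg S -> Prop)
    (E' : I' -> cfg S -> cfg S -> Prop) (pi : I -> I') :
  (forall i a a', E' (pi i) a a' -> E i a a') -> decays E' -> decays E.
Proof.
move=> EE' [rho [rho01 dec]]; exists rho; split=> // n f fE.
pose f' i' c := \prod_(i | pi i == i') f i c.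
have f'E i' : local_fun (E' i') (f' i').
  split=> [c|c c' e].
    by rewrite normr_prod; apply: prodr_ile1 => i _; rewrite normr_ge0 /=; case: (fE i) => ->.
  apply: eq_bigr => i /eqP ii'; case: (fE i) => _; apply=> k; apply: EE'.
  by rewrite ii'.
suff -> : \sum_(c : {ffun 'I_n -> cfg S}) (\prod_k (wt (c k) * phase (c k))) * \prod_i f i c =
  \sum_(c : {ffun 'I_n -> cfg S}) (\prod_k (wt (c k) * phase (c k))) * \prod_i f' i c.
  exact: dec.
by apply: eq_bigr => c _; rewrite [in LHS](partition_big pi predT).
Qed.

Lemma nd_map (B B' : Type) (m : B -> B') (I I' : finType) (E : I -> B -> B -> Prop)
    (E' : I' -> B' -> B' -> Prop) (pi : I -> I') (Q : B -> L -> Prop) (Q' : B' -> L -> Prop) :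
  (forall i a a', E' (pi i) (m a) (m a') -> E i a a') ->
  (forall v t, Q' v t -> exists2 a, Q a t & v = m a) ->
  nd E Q -> nd E' Q'.
Proof.
move=> EE' Q'Q [S [b [dec Qb]]]; exists S, (fun c => m (b c)); split.
  by apply: contra_not dec; apply: decays_coarsen => i a a'; apply: EE'.
by move=> v t /Q'Q [a /Qb [c [c0 <- <-]] ->]; exists c.
Qed.

End Coarsen.

Lemma fin_uniform (X : finType) (P : X -> nat -> Prop) :
  (forall x k k', (k <= k')%N -> P x k -> P x k') ->
  (forall x, exists k, P x k) -> exists k, forall x, P x k.
Proof.
move=> Pmono PX.
suff [k Pk] : exists k, forall x, x \in enum X -> P x k.
  by exists k => x; apply: Pk; rewrite mem_enum.
elim: (enum X) => [|x s [k Pk]]; first by exists 0.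
have [k' Pk'] := PX x; exists (maxn k k') => y; rewrite inE => /predU1P[->|/Pk].
  exact: Pmono (leq_maxr _ _) Pk'.
exact: Pmono (leq_maxl _ _).
Qed.

Lemma perm_eq_closure (T : eqType) (R : seq T -> seq T -> Prop) :
  (forall s, R s s) -> (forall s1 s2 s3, R s1 s2 -> R s2 s3 -> R s1 s3) ->
  (forall a b u v, R (a :: u ++ b :: v) (b :: u ++ a :: v)) ->
  forall s s', perm_eq s s' -> R s s'.
Proof.
move=> Rr Rt Rx.
(* An exchange away from the head is a product of three exchanges with the head [c]. *)
have Rw w a b u v : R (w ++ a :: u ++ b :: v) (w ++ b :: u ++ a :: v).
  case: w => [|c w]; first exact: Rx.
  apply: (Rt _ (a :: w ++ c :: u ++ b :: v)); first exact: Rx.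
  apply: (Rt _ (b :: w ++ c :: u ++ a :: v)); last exact: Rx.
  by rewrite -!(cat_cons c) !catA; apply: Rx.
move=> s s' ss'; rewrite -[s]cat0s -[s']cat0s; move: [::] => w.
elim: s s' w ss' => [|a s IH] s' w; first by rewrite perm_sym => /perm_nilP ->.
move=> ss'; have : a \in s' by rewrite -(perm_mem ss') mem_head.
move=> /splitPr as'; case: as' ss' => u v ss'.
have {ss'} : perm_eq s (u ++ v).
  by rewrite -(perm_cons a) (permPl ss') (perm_catCA u [:: a] v).
case: u => [|c u] ss'; first by rewrite -!(cat_rcons a); apply: IH.
apply: (Rt _ (w ++ a :: u ++ c :: v)); last exact: Rw.
rewrite -!(cat_rcons a); apply: IH.
by rewrite perm_sym (perm_catCA u [:: c] v) perm_sym.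
Qed.

(** * Systems acting on words *)

Section Splice.
Variables (L : numClosedFieldType) (W : eqType).

(** This is 2^s. A word of level s has a head letter, through which systems are glued, and 2^s
    further letters. *)
Fixpoint width s := if s is s'.+1 then (width s' + width s')%N else 1.

Definition word s := (W * (width s).-tuple W)%type.

Variable Q : word 0 * word 0 -> L -> Prop.

(* Gluing two copies along the first output letter; the inputs of the second copy become outputs,
   because its phase is conjugated. *)
Definition splice_boundary s (v w : word s * word s) : word s.+1 * word s.+1 :=
  ((v.1.1, [tuple of v.1.2 ++ w.2.2]), (w.1.1, [tuple of v.2.2 ++ w.1.2])).

Fixpoint splice s : word s * word s -> L -> Prop :=
  match s with
  | 0 => Q
  | s'.+1 => fun v t => exists a b x y,
      [/\ splice a x, splice b y, a.2.1 = b.2.1, v = @splice_boundary s' a b & t = x / y]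
  end.

Lemma nd_splice s : nd (@wires4 _ _) Q -> nd (@wires4 _ _) (@splice s).
Proof.
move=> ndQ; elim: s => [//|s].
apply: (nd_glue (key := fun v => v.2.1) (m := @splice_boundary s)
  (g := fun i => i == (false, true))
  (pi1 := id) (pi2 := fun i => if i == (true, true) then (false, true) else (~~ i.1, i.2))).
- by move=> [[] []].
- move=> [[] []] //= a b a' b' _ /(congr1 val)/= /eqP; rewrite eqseq_cat ?size_tuple //;
  by case/andP=> /eqP ? _; apply: val_inj.
- move=> [[] []] //= a b a' b' _ /(congr1 val)/= /eqP; rewrite eqseq_cat ?size_tuple //;
  by case/andP=> _ /eqP ?; apply: val_inj.
move=> v t [a [b [x [y [ax b_y ab -> ->]]]]]; by exists a, b, x, y.
Qed.

Definition rewrites s (u v : seq W) (t : L) := exists a b : word s,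
  [/\ u = a.1 :: a.2, v = b.1 :: b.2 & splice (a, b) t].

(** The first system carries the head a to b and I to O; the second, run backwards, carries b on to
    c and O' to I'. *)
Lemma rewritesS s a b c (I O I' O' : seq W) x y :
  rewrites s (a :: I) (b :: O) x -> rewrites s (c :: I') (b :: O') y ->
  rewrites s.+1 (a :: I ++ O') (c :: O ++ I') (x / y).
Proof.
case=> p [q [e1 e2 pq]]; case=> p' [q' [e3 e4 pq']].
case: e1 e2 e3 e4 => -> -> [-> ->] [-> ->] [qq' ->].
exists (splice_boundary (p, q) (p', q')).1, (splice_boundary (p, q) (p', q')).2.
by split=> //; exists (p, q), (p', q'), x, y.
Qed.

Variable good : pred W.

Lemma rewrites_id s :
  (forall u, all good u -> size u = 2 -> rewrites 0 u u 1) ->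
  forall u, all good u -> size u = (width s).+1 -> rewrites s u u 1.
Proof.
move=> id0; elim: s => [|s IH] u ug; first exact: id0.
case: u ug => [//|a u] /= /andP[ag ug] [su].
rewrite -(cat_take_drop (width s) u) in ug *; rewrite all_cat in ug.
case/andP: ug => tg dg; rewrite -[X in rewrites _ _ _ X]divr1.
apply: rewritesS; apply: IH; rewrite /= ?ag //.
  by rewrite size_takel // su leq_addr.
by rewrite size_drop su addnK.
Qed.

Lemma rewrites_head s a b t :
  (forall u, all good u -> size u = 2 -> rewrites 0 u u 1) -> good b ->
  (forall u, all good u -> size u = 1%N -> rewrites 0 (a :: u) (b :: u) t) ->
  forall u, all good u -> size u = width s -> rewrites s (a :: u) (b :: u) t.
Proof.
move=> id0 bg ab0; elim: s => [|s IH] u ug; first exact: ab0.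
move=> /= su; rewrite -(cat_take_drop (width s) u) in ug *; rewrite all_cat in ug.
case/andP: ug => tg dg; rewrite -[X in rewrites _ _ _ X]divr1.
apply: rewritesS; first by apply: IH; rewrite ?size_takel // su leq_addr.
by apply: rewrites_id; rewrite /= ?bg // size_drop su addnK.
Qed.

(* An exchange performed in the second block is read backwards, so it has to be an involution. *)
Lemma rewrites_exchange s (f : W -> W -> W * W) :
  (forall u, all good u -> size u = 2 -> rewrites 0 u u 1) ->
  (forall a c, good a -> good c -> good (f a c).1 /\ good (f a c).2) ->
  (forall a c, f (f a c).1 (f a c).2 = (a, c)) ->
  (forall a c, good a -> good c -> rewrites 0 [:: a; c] [:: (f a c).1; (f a c).2] 1) ->
  forall a c u v, good a -> good c -> all good u -> all good v ->
  (size u + size v).+1 = width s ->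
  rewrites s (a :: u ++ c :: v) ((f a c).1 :: u ++ (f a c).2 :: v) 1.
Proof.
move=> id0 fg ff f0; elim: s => [|s IH] a c u v ag cg ug vg.
  by case: u ug => [|//] _; case: v vg => [|//] _ _; apply: f0.
have [fag fcg] := fg a c ag cg.
(* This decides which block contains [c]; the other block acts as the identity. *)
move=> /= suv; have [us|us] := ltnP (size u) (width s).
  have e : v = take (width s - (size u).+1) v ++ drop (width s - (size u).+1) v.
    by rewrite cat_take_drop.
  have vs : (width s - (size u).+1 <= size v)%N.
    by rewrite leq_subLR addSn suv leq_addr.
  have : all good v by []; rewrite {1}e all_cat => /andP[tg dg].
  have cE x : u ++ x :: v =
      (u ++ x :: take (width s - (size u).+1) v) ++ drop (width s - (size u).+1) v.
    by rewrite -catA /= -e.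
  rewrite !cE -[X in rewrites _ _ _ X]divr1; apply: rewritesS.
    by apply: IH => //; rewrite size_takel // -addSn subnKC.
  apply: rewrites_id; rewrite /= ?fag // size_drop subnBA //.
  by rewrite addnS addnC suv addnK.
have e : u = take (width s) u ++ drop (width s) u by rewrite cat_take_drop.
have : all good u by []; rewrite {1}e all_cat => /andP[tg dg].
rewrite e -!catA -[X in rewrites _ _ _ X]divr1; apply: rewritesS.
  by apply: rewrites_id; rewrite /= ?ag // size_takel.
have -> : (a :: drop (width s) u ++ c :: v) =
  (f (f a c).1 (f a c).2).1 :: drop (width s) u ++ (f (f a c).1 (f a c).2).2 :: v.
  by rewrite ff.
apply: IH => //; rewrite size_drop; apply/eqP; rewrite -(eqn_add2r (width s)) -suv.
by rewrite !addSn addnAC subnK.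
Qed.

End Splice.

(** * Extension of characters *)

Section Extension.
Variables (L : numClosedFieldType) (Z : finType).
Implicit Types (v w : {ffun Z -> int}) (c : Z -> L).

Lemma norm1_exprz (a : L) (n : int) : `|a| = 1 -> `|a ^ n| = 1.
Proof.
move=> a1; case: n => n; first by rewrite -exprnP normrX a1 expr1n.
by rewrite NegzE -invr_expz -exprnP normfV normrX a1 expr1n invr1.
Qed.

Definition chi c v : L := \prod_z c z ^ v z.

Lemma chi0 c : chi c 0 = 1.
Proof. by rewrite /chi big1 // => z _; rewrite ffunE expr0z. Qed.

Lemma chiB c v w : (forall z, c z != 0) -> chi c (v - w) = chi c v / chi c w.
Proof.
move=> c0; rewrite /chi -prodf_div; apply: eq_bigr => z _.
by rewrite !ffunE expfzDr // invr_expz.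
Qed.

Lemma chi_norm c v : (forall z, `|c z| = 1) -> `|chi c v| = 1.
Proof. by move=> c1; rewrite /chi normr_prod big1 // => z _; rewrite norm1_exprz. Qed.

(* Values of norm 1 form a divisible group, so a homomorphism defined on a subgroup of the free
   abelian group over Z, presented here by its graph H, extends to the whole group. *)
Lemma extend_character (H : {ffun Z -> int} -> L -> Prop) :
  (forall v w t u, H v t -> H w u -> H (v - w) (t / u)) ->
  (forall t, H 0 t -> t = 1) -> (forall v t, H v t -> `|t| = 1) ->
  exists c, (forall z, `|c z| = 1) /\ forall v t, H v t -> t = chi c v.
Proof.
move=> HB H0 H1.
have c_neq0 c : (forall z, `|c z| = 1) -> forall z, c z != 0.
  by move=> c1 z; rewrite -normr_eq0 c1 oner_eq0.
(* Induction on a list of the coordinates in which elements of the subgroup [K] may be nonzero. *)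
suff main (s : seq Z) (K : {ffun Z -> int} -> L -> Prop) :
    (forall v t, K v t -> H v t) ->
    (forall v w t u, K v t -> K w u -> K (v - w) (t / u)) ->
    (forall v t, K v t -> forall z, z \notin s -> v z = 0) ->
    exists c, (forall z, `|c z| = 1) /\ forall v t, K v t -> t = chi c v.
  by apply: (main (enum Z) H) => // v t _ z; rewrite mem_enum.
elim: s K => [|a s IH] K KH KB Ks.
  exists (fun _ => 1); split=> [z|v t Kvt]; first exact: normr1.
  have v0 : v = 0 by apply/ffunP => z; rewrite ffunE (Ks _ _ Kvt).
  by move: (KH _ _ Kvt); rewrite v0 chi0 => /H0.
have [|||c [c1 cP]] := IH (fun v t => K v t /\ v a = 0).
- by move=> v t [/KH].
- by move=> v w t u [Kv va] [Kw wa]; split; [exact: KB | rewrite !ffunE va wa subr0].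
- move=> v t [Kv va] z zs; have [->//|za] := eqVneq z a.
  by apply: (Ks _ _ Kv); rewrite inE negb_or za.
have [d0|nd0] := pselect (forall v t, K v t -> v a = 0).
  by exists c; split=> // v t Kvt; apply: cP; split; last exact: d0 Kvt.
have K0 v t : K v t -> K 0 1.
  move=> Kv; have := KB _ _ _ _ Kv Kv; rewrite subrr divff //.
  by rewrite -normr_eq0 (H1 _ _ (KH _ _ Kv)) oner_eq0.
have KN v t : K v t -> K (- v) t^-1.
  by move=> Kv; have := KB _ _ _ _ (K0 _ _ Kv) Kv; rewrite sub0r div1r.
(* The [a]-coordinates of [K] form a subgroup of the integers; its least positive element [d] is
   attained at some [v]. *)
pose P (d : nat) := (0 < d)%N && `[< exists v t, K v t /\ v a = d%:Z >].
have exP : exists d, P d.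
  apply: contrapT => noP; apply: nd0 => v t Kv; apply: contrapT => va.
  apply: noP; exists `|v a|%N; rewrite /P absz_gt0; apply/andP; split; first exact/eqP.
  apply/asboolP; have [va0|va0] := leP 0 (v a).
    by exists v, t; rewrite gez0_abs.
  by exists (- v), t^-1; rewrite ltz0_abs // ffunE; split; first exact: KN.
have [d /andP[d0 /asboolP [v [t [Kv va]]]] dmin] := ex_minnP exP.
pose e := \prod_(z | z != a) c z ^ v z.
have e1 : `|e| = 1.
  by rewrite normr_prod big1 // => z _; rewrite norm1_exprz.
have e0 : e != 0 by rewrite -normr_eq0 e1 oner_eq0.
(* The value at [a] that gives the new character the value [t] at [v]; [e] is the contribution of
   the other coordinates. *)
pose g := d.-root (t / e).
have g1 : `|g| = 1.
  apply/eqP; rewrite -(@pexpr_eq1 _ `|g| d) //.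
  by rewrite -normrX rootCK // normrM normfV e1 (H1 _ _ (KH _ _ Kv)) divr1.
pose c' z := if z == a then g else c z.
have c'1 z : `|c' z| = 1 by rewrite /c'; case: ifP.
have c'0 := c_neq0 _ c'1.
exists c'; split=> //.
have chi_v : t = chi c' v.
  rewrite /chi (bigD1 a) //= {1}/c' eqxx va (_ : g ^ d%:Z = t / e); last exact: rootCK.
  rewrite (_ : \prod_(i | i != a) c' i ^ v i = e) ?divfK //.
  by apply: eq_bigr => z /negbTE za; rewrite /c' za.
(* Subtracting [v] lowers the [a]-coordinate by [d] until it is 0, where [c] is already right. *)
have pos n : forall w u, K w u -> w a = n%:Z -> u = chi c' w.
  elim/ltn_ind: n => n IHn w u Kw wa.
  have [n0|n0] := posnP n.
    rewrite (cP w u); last by rewrite wa n0.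
    apply: eq_bigr => z _; rewrite /c'; case: eqP => // ->.
    by rewrite wa n0 !expr0z.
  have dn : (d <= n)%N by apply: dmin; rewrite /P n0; apply/asboolP; exists w, u.
  have := IHn (n - d)%N _ _ _ (KB _ _ _ _ Kw Kv); rewrite !ffunE wa va chiB //.
  rewrite subzn // ltn_subrL d0 n0 => /(_ isT erefl) => e'.
  have t0 : t != 0 by rewrite -normr_eq0 (H1 _ _ (KH _ _ Kv)) oner_eq0.
  by rewrite -[u](divfK t0) e' -chi_v divfK.
move=> w u Kw; have [wa|wa] := leP 0 (w a).
  by apply: (pos `|w a|%N) => //; rewrite gez0_abs.
have := pos `|w a|%N _ _ (KN _ _ Kw); rewrite ltz0_abs // ffunE => /(_ erefl).
by rewrite -[- w]sub0r chiB // chi0 div1r => /invr_inj.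
Qed.

End Extension.

(** * Walks with balanced content have phase 1 *)

Section Paths.
Variables (L : numClosedFieldType) (X Y Z : finType).
Let point := (X * Y * Z)%type.
Variables (supp : pred point) (T : point -> L).
Let px (p : point) := p.1.1.
Let py (p : point) := p.1.2.
Let pz (p : point) := p.2.

Definition pointQ (p : point) (t : L) := supp p /\ t = T p.

Hypothesis ndQ : nd (@wires3 X Y Z) pointQ.

Lemma T_neq0 p : supp p -> T p != 0.
Proof. by move=> ps; rewrite -normr_eq0 (nd_norm ndQ (conj ps erefl)) oner_eq0. Qed.

Lemma T_div p : supp p -> T p / T p = 1.
Proof. by move=> /T_neq0 T0; rewrite divff. Qed.

(** A path of level r has 2^(r+1) points; the first two are recorded separately. *)
Fixpoint path_len r := if r is r'.+1 then (path_len r' + (path_len r').+2)%N else 0.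

(* Read off a path p_1, ..., p_N (with p_1, p_2 on a common x, p_2, p_3 on a common z, and so on):
   the points p_1 and p_2, the y-letters of p_3, ..., p_N in some order, and the z-letter of p_N. *)
Definition path_bd r := (point * point * (path_len r).-tuple Y * Z)%type.

Definition path_wires r (i : option (bool * bool)) (v w : path_bd r) : Prop :=
  match i with
  | Some (true, true) => pz v.1.1.1 = pz w.1.1.1
  | Some (true, false) => py v.1.1.1 = py w.1.1.1
  | Some (false, true) => py v.1.1.2 = py w.1.1.2
  | Some (false, false) => v.2 = w.2
  | None => v.1.2 = w.1.2
  end.

Definition path_join r (a b : path_bd r) : path_bd r.+1 :=
  (a.1.1.1, a.1.1.2, [tuple of a.1.2 ++ [tuple of py b.1.1.1 :: py b.1.1.2 :: b.1.2]],
   pz b.1.1.1).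

Fixpoint pathQ r : path_bd r -> L -> Prop :=
  match r with
  | 0 => fun v t => exists p q, [/\ supp p, supp q, px p = px q,
      v = (p, q, [tuple], pz q) & t = T p / T q]
  | r'.+1 => fun v t => exists a b s u,
      [/\ pathQ a s, pathQ b u, a.2 = b.2, v = @path_join r' a b & t = s / u]
  end.

Lemma nd_path r : nd (@path_wires r) (@pathQ r).
Proof.
elim: r => [|r].
  apply: (nd_glue (key := px) (m := fun p q : point => (p, q, [tuple], pz q) : path_bd 0)
    (g := fun i => i == Some true)
    (pi1 := fun i => if i is None then Some (true, true) else Some (true, false))
    (pi2 := fun i => if i is None then Some (false, false) else Some (false, true))) ndQ.
  - by move=> [[]|].
  - by move=> [[]|].
  - by move=> [[]|].
  move=> v t [p [q [ps qs pq -> ->]]].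
  by exists p, q, (T p), (T q).
apply: (nd_glue (key := fun v => v.2) (m := @path_join r)
  (g := fun i => i == Some (false, false)) (pi1 := id)
  (pi2 := fun i => if i == Some (true, true) then Some (false, false) else None)).
- by move=> [[[] []]|].
- move=> [[[] []]|] //= a b a' b' _ /(congr1 val)/= /eqP; rewrite eqseq_cat ?size_tuple //.
  by case/andP=> /eqP ? _; apply: val_inj.
- move=> [[[] []]|] //= a b a' b' _ /(congr1 val)/= /eqP; rewrite eqseq_cat ?size_tuple //.
  + by case/andP=> _ /eqP [].
  + by case/andP=> _ /eqP [].
  + by case/andP=> _ /eqP [_ _ ?]; apply: val_inj.
by [].
Qed.

(** The path goes from [x] to [p] and then rests at [o], where the phases cancel in pairs. *)
Lemma path_loop r x p o : supp x -> supp p -> supp o -> px x = px p -> pz o = pz p ->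
  @pathQ r (x, p, nseq_tuple _ (py o), pz p) (T x / T p).
Proof.
move=> xs ps os xp; elim: r x p xs ps xp => [|r IH] x p xs ps xp op.
  by exists x, p; split=> //; congr (_, _, _); apply: val_inj.
exists (x, p, nseq_tuple _ (py o), pz p), (o, o, nseq_tuple _ (py o), pz o),
  (T x / T p), (T o / T o).
split; [exact: IH | exact: IH | by rewrite /= op | | by rewrite T_div // divr1].
congr (_, _, _); last exact/esym.
apply: val_inj; rewrite /= -[_ :: _ :: nseq _ _]/(nseq (path_len r).+2 (py o)).
exact: nseqD.
Qed.

Definition reach r z z' := exists p q l t, pz p = z /\ @pathQ r (p, q, l, z') t.

Lemma reach_sym r z z' : reach r z z' -> reach r z' z.
Proof.
move=> [p [q [l [t [<- ]]]]]; case: r l => [|r] l.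
  move=> [a [b [asupp bsupp ab [-> _ _ ->] _]]].
  by exists b, a, [tuple], (T b / T a); split=> //; exists b, a.
move=> [a [b [s [u [aQ bQ ab [-> _ _ ->] _]]]]].
exists b.1.1.1, b.1.1.2, (path_join b a).1.2, (u / s); split=> //.
by exists b, a, u, s.
Qed.

Lemma reach_trans r z z' z'' : reach r z z' -> reach r z' z'' -> reach r.+1 z z''.
Proof.
move=> [p [q [l [t [<- pQ]]]]] /reach_sym [p' [q' [l' [t' [<- pQ']]]]].
exists p, q, (path_join (p, q, l, z') (p', q', l', z')).1.2, (t / t'); split=> //.
by exists (p, q, l, z'), (p', q', l', z'), t, t'.
Qed.

(** Connectivity as an induction principle: steps between [h]-values over a common [f]-value lead
    everywhere. *)
Definition connects (A B : Type) (f : point -> A) (h : point -> B) :=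
  forall R : B -> B -> Prop, (forall b, R b b) ->
  (forall b1 b2 b3, R b1 b2 -> R b2 b3 -> R b1 b3) ->
  (forall p q, supp p -> supp q -> f p = f q -> R (h p) (h q)) -> forall b b', R b b'.

Hypothesis x_onto : forall x, exists2 p, supp p & px p = x.
Hypothesis z_onto : forall z, exists2 p, supp p & pz p = z.
Hypothesis conn_xz : connects px pz.
Hypothesis conn_zx : connects pz px.
Hypothesis conn_yz : connects py pz.
Hypothesis conn_yx : connects py px.

Lemma reach_refl r z : reach r z z.
Proof.
have [p ps <-] := z_onto z.
by exists p, p, (nseq_tuple _ (py p)), (T p / T p); split=> //; apply: path_loop.
Qed.

Lemma reach_leq r r' z z' : (r <= r')%N -> reach r z z' -> reach r' z z'.
Proof.
move=> /subnKC <- zz'; elim: (_ - _)%N => [|j IH]; rewrite ?addn0 // addnS.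
exact: reach_trans IH (reach_refl _ _).
Qed.

(** One level must serve all pairs, since all paths are to live in one system; constant paths raise
    the level. *)
Lemma reach_all : exists r, forall z z', reach r z z'.
Proof.
have ex_reach z z' : exists r, reach r z z'.
  move: z z'; apply: conn_xz => [z|z z' z'' [r zz'] [r' z'z'']|p q ps qs pq].
  - by exists 0; apply: reach_refl.
  - exists (maxn r r').+1; apply: reach_trans (reach_leq (leq_maxl _ _) zz') _.
    exact: reach_leq (leq_maxr _ _) z'z''.
  by exists 0, p, q, [tuple], (T p / T q); split=> //; exists p, q.
have [r rP] := @fin_uniform (Z * Z)%type (fun zz r => reach r zz.1 zz.2)
  (fun zz _ _ le_rr => reach_leq le_rr) (fun zz => ex_reach _ _).
by exists r => z z'; apply: (rP (z, z')).
Qed.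

(* A walk in the graph of x-letters sharing a y-letter: the step (p, p') leads from the x-letter of p
   to that of p', trading the z-letter of p for that of p'. *)
Fixpoint walk x (ms : seq (point * point)) x' : bool :=
  if ms is m :: ms' then
    [&& supp m.1, supp m.2, py m.1 == py m.2, px m.1 == x & walk (px m.2) ms' x']
  else x == x'.

Definition walk_val (ms : seq (point * point)) := \prod_(m <- ms) (T m.1 / T m.2).

(** * Ladders: moving and exchanging letters *)

Section Ladders.
Variable r : nat.
Hypothesis rP : forall z z', reach r z z'.

Let node := (Z * point)%type.
Let letters := (Y * Y * (path_len r).-tuple Y * (path_len r).-tuple Y)%type.

(* A path from z to z(p_N) whose last point q = p_N is kept whole: the node (z, q) stands for the pair
   (z, x q), the letter y of p_(N-1) stays open, the other letters y are to be glued. *)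
Definition base_join (a b : path_bd r) : node * Y * letters :=
  ((pz a.1.1.1, b.1.1.1), py b.1.1.2, (py a.1.1.1, py a.1.1.2, a.1.2, b.1.2)).

Definition baseQ (v : node * Y * letters) t := exists a b s u,
  [/\ @pathQ r a s, @pathQ r b u, a.2 = b.2, v = base_join a b & t = s / u].

Lemma nd_base : nd (@wires3 _ _ _) baseQ.
Proof.
apply: (nd_glue (key := fun v => v.2) (m := base_join)
  (g := fun i => i == Some (false, false))
  (pi1 := fun i => if i == Some (true, true) then Some true else None)
  (pi2 := fun i => match i with
    | Some (true, _) => Some true | Some (false, _) => Some false | None => None end)
  _ _ _ _ (nd_path r)).
- by move=> [[[] []]|].
- by move=> [[[] []]|] //= a b a' b' _ [].
- by move=> [[[] []]|] //= a b a' b' _ [] // _ ->.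
by [].
Qed.

(** The letters [l] and the factor [k] do not depend on the points [x] and [p] prolonging the
    path. *)
Lemma base_far z z1 : exists l k, k != 0 /\ forall x p, supp x -> supp p ->
  px p = px x -> pz p = z1 -> baseQ ((z, x), py p, l) (k * (T p / T x)).
Proof.
have [p1 [p2 [l [k [<- kQ]]]]] := rP z z1; have [o os oz] := z_onto z1.
exists (py p1, py p2, l, nseq_tuple _ (py o)), k; split.
  by rewrite -normr_eq0 (nd_norm (nd_path r) kQ) oner_eq0.
move=> x p xs ps xp pz1; exists (p1, p2, l, z1), (x, p, nseq_tuple _ (py o), pz p), k, (T x / T p).
split=> //; [by apply: path_loop => //; rewrite oz | by rewrite invf_div].
Qed.

(** A path standing still at [p] shows only the letter [y], whatever [p] is. *)
Lemma base_near y : exists l, forall x p, supp x -> supp p ->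
  px p = px x -> py p = y -> baseQ ((pz p, x), y, l) (T p / T x).
Proof.
exists (y, y, nseq_tuple _ y, nseq_tuple _ y) => x p xs ps xp <-.
exists (p, p, nseq_tuple _ (py p), pz p), (x, p, nseq_tuple _ (py p), pz p),
  (T p / T p), (T x / T p).
by split=> //; [apply: path_loop | apply: path_loop | rewrite T_div // invf_div mul1r].
Qed.

Definition pairQ (v : node * node * (letters * letters)) t := exists y s u,
  [/\ baseQ (v.1.1, y, v.2.1) s, baseQ (v.1.2, y, v.2.2) u & t = s / u].

Lemma nd_pair : nd (@wires3 _ _ _) pairQ.
Proof.
apply: (nd_glue (key := fun v => v.1.2) (m := fun v w => (v.1.1, w.1.1, (v.2, w.2)))
  (g := fun i => i == Some false) (pi1 := id)
  (pi2 := fun i => if i is None then None else Some false) _ _ _ _ nd_base).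
- by move=> [[]|].
- by move=> [[]|] //= a b a' b' _ [].
- by move=> [[]|] //= a b a' b' _ [].
move=> [[a b] [l l']] t [y [s [u [aQ bQ ->]]]].
by exists (a, y, l), (b, y, l'), s, u.
Qed.

Lemma pairQ_neq0 v t : pairQ v t -> t != 0.
Proof. by move=> /(nd_norm nd_pair) t1; rewrite -normr_eq0 t1 oner_eq0. Qed.

Let ladder (e e' : node * node) t := linked pairQ e e' t.

Lemma ladder_trans1 e e' e'' t : ladder e e' 1 -> ladder e' e'' t -> ladder e e'' t.
Proof. by move=> e1 e2; rewrite -[t]mul1r; apply: linked_trans e1 e2; apply: pairQ_neq0. Qed.

(* Prolong a path from z and a path from z' to a common letter z1 by the same point p on z1; changing p
   to another point on z1 affects no glued letter. *)
Lemma ladder_x z z' x v : supp x -> supp v -> ladder ((z, x), (z', x)) ((z, v), (z', v)) 1.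
Proof.
move=> xs vs.
have pair p w z1 l l' k k' : supp w -> px p = px w ->
  (forall x p, supp x -> supp p -> px p = px x -> pz p = z1 ->
    baseQ ((z, x), py p, l) (k * (T p / T x))) ->
  (forall x p, supp x -> supp p -> px p = px x -> pz p = z1 ->
    baseQ ((z', x), py p, l') (k' * (T p / T x))) ->
  supp p -> pz p = z1 -> k' != 0 ->
  pairQ ((z, w), (z', w), (l, l')) (k / k').
  move=> ws pw lP l'P ps pz1 k'0; exists (py p), (k * (T p / T w)), (k' * (T p / T w)).
  split; [exact: lP | exact: l'P |].
  by field; rewrite k'0 !T_neq0.
suff main : forall a b, forall x v, supp x -> supp v -> px x = a -> px v = b ->
    ladder ((z, x), (z', x)) ((z, v), (z', v)) 1 by exact: (main _ _ x v).
move=> a b {x v xs vs}; move: a b.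
have step p q x v : supp p -> supp q -> supp x -> supp v ->
  pz p = pz q -> px x = px p -> px v = px q -> ladder ((z, x), (z', x)) ((z, v), (z', v)) 1.
  move=> ps qs xs vs pq xp vq.
  have [l [k [k0 lP]]] := base_far z (pz q); have [l' [k' [k'0 l'P]]] := base_far z' (pz q).
  have kk : k / k' != 0 by rewrite mulf_neq0 ?invr_eq0.
  rewrite -(divff kk); apply: (linked_shared (d := (l, l'))).
    exact: (pair p _ _ _ _ _ _ _ _ lP l'P).
  exact: (pair q _ _ _ _ _ _ _ _ lP l'P).
apply: conn_zx => [a x v xs vs xa va|a b c ab bc x v xs vs xa vc|p q ps qs pq x v xs vs xp vq].
- by apply: (step x x) => //; rewrite va xa.
- have [w ws wb] := x_onto b.
  by apply: ladder_trans1 (ab _ _ xs ws xa wb) (bc _ _ ws vs wb vc).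
exact: (step p q).
Qed.

(** The z-letter changes along points p, q with a common y-letter: paths standing still at p and at
    q show the same letters. *)
Lemma ladder_diag z z' x v : supp x -> supp v -> ladder ((z, x), (z, x)) ((z', v), (z', v)) 1.
Proof.
move=> xs vs; move: z z' x v xs vs; suff main : forall z z', forall x v, supp x -> supp v ->
    ladder ((z, x), (z, x)) ((z', v), (z', v)) 1 by move=> z z' x v; apply: main.
apply: conn_yz => [z x v xs vs|z z' z'' zz' z'z'' x v xs vs|p q ps qs pq x v xs vs].
- exact: ladder_x.
- by apply: ladder_trans1 (zz' _ x xs xs) (z'z'' _ _ xs vs).
apply: ladder_trans1 (ladder_x _ _ xs ps) _; apply: ladder_trans1 (ladder_x _ _ qs vs).
have [l lP] := base_near (py p).
rewrite -[X in ladder _ _ X]divr1; apply: (linked_shared (d := (l, l))).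
  exists (py p), (T p / T p), (T p / T p).
  by split; [exact: lP | exact: lP | rewrite !T_div // divr1].
exists (py p), (T q / T q), (T q / T q).
by split; [exact: lP | exact: lP | rewrite !T_div // divr1].
Qed.

(* A path standing still at p and one standing still at p' read the same letter y, hence can be glued,
   along all of their y-letters, to two copies of the former. *)
Lemma ladder_move p p' x x' e : supp p -> supp p' -> supp x -> supp x' ->
  py p = py p' -> px p = px x -> px p' = px x' -> supp e.2 ->
  ladder ((pz p, x), (pz p', x')) (e, e) ((T p / T x) / (T p' / T x')).
Proof.
move=> ps p's xs x's pp' xp x'p' es; case: e es => z v vs.
rewrite -[X in ladder _ _ X]mulr1.
apply: (linked_trans pairQ_neq0 (e' := ((pz p, x), (pz p, x)))); last exact: ladder_diag.
have [l lP] := base_near (py p).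
rewrite -[X in linked _ _ _ X]divr1; apply: (linked_shared (d := (l, l))).
  by exists (py p), (T p / T x), (T p' / T x'); split=> //; apply: lP.
exists (py p), (T p / T x), (T p / T x); split; [exact: lP | exact: lP |].
by rewrite divff // mulf_neq0 ?invr_eq0 ?T_neq0.
Qed.

Lemma ladder_uniform (I : finType) (c : pred I) (e e' : I -> node * node) (t : I -> L) :
  (forall i, c i -> ladder (e i) (e' i) (t i)) ->
  exists k, forall k', (k <= k')%N -> forall i, c i -> chain pairQ k' (e i, e' i) (t i).
Proof.
move=> cl.
have [k kP] := @fin_uniform I (fun i k => c i -> chain pairQ k (e i, e' i) (t i))
  (fun i k k' kk' ck ci => chain_leq pairQ_neq0 kk' (ck ci))
  (fun i => match boolP (c i) with
    | AltTrue ci => let: ex_intro k kc := cl i ci in ex_intro _ k (fun _ => kc)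
    | AltFalse nci => ex_intro _ 0 (fun ci => False_ind _ (negP nci ci)) end).
by exists k => k' kk' i ci; apply: chain_leq kk' (kP i ci); apply: pairQ_neq0.
Qed.

(** All moves must belong to one system, hence have one height; there are finitely many, and heights
    can be raised. *)
Lemma ladder_height : exists k, [/\
  forall e e' : node, supp e.2 -> supp e'.2 -> chain pairQ k ((e, e), (e', e')) 1,
  forall z z' x v, supp x -> supp v ->
    chain pairQ k (((z, x), (z', x)), ((z, v), (z', v))) 1 &
  forall p p' x x' e, supp p -> supp p' -> supp x -> supp x' ->
    py p = py p' -> px p = px x -> px p' = px x' -> supp e.2 ->
    chain pairQ k (((pz p, x), (pz p', x')), (e, e)) ((T p / T x) / (T p' / T x'))].
Proof.
have [k1 k1P] := @ladder_uniform (node * node)%type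
  (fun i => supp i.1.2 && supp i.2.2) (fun i => (i.1, i.1)) (fun i => (i.2, i.2)) (fun _ => 1)
  (fun i => ltac:(case: i => [[z x] [z' v]] /= /andP[xs vs]; exact: ladder_diag)).
have [k2 k2P] := @ladder_uniform (Z * Z * point * point)%type
  (fun i => supp i.1.2 && supp i.2)
  (fun i => ((i.1.1.1, i.1.2), (i.1.1.2, i.1.2))) (fun i => ((i.1.1.1, i.2), (i.1.1.2, i.2)))
  (fun _ => 1)
  (fun i => ltac:(case: i => [[[z z'] x] v] /= /andP[xs vs]; exact: ladder_x)).
have [k3 k3P] := @ladder_uniform (point * point * point * point * node)%type
  (fun i => [&& supp i.1.1.1.1, supp i.1.1.1.2, supp i.1.1.2, supp i.1.2,
    py i.1.1.1.1 == py i.1.1.1.2, px i.1.1.1.1 == px i.1.1.2, px i.1.1.1.2 == px i.1.2 &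
    supp i.2.2])
  (fun i => ((pz i.1.1.1.1, i.1.1.2), (pz i.1.1.1.2, i.1.2))) (fun i => (i.2, i.2))
  (fun i => (T i.1.1.1.1 / T i.1.1.2) / (T i.1.1.1.2 / T i.1.2))
  (fun i => ltac:(case: i => [[[[p p'] x] x'] e] /= /and5P[ps p's xs x's]
     /and4P[/eqP pp' /eqP xp /eqP x'p' es];
     exact: ladder_move)).
exists (maxn k1 (maxn k2 k3)).
split=> [e e' es e's|z z' x v xs vs|p p' x x' e ps p's xs x's pp' xp xp' es].
- by apply: (k1P _ _ (e, e')); rewrite ?leq_maxl //= es e's.
- by apply: (k2P _ _ (z, z', x, v)); rewrite ?leq_max ?leqnn ?orbT //= xs vs.
apply: (k3P _ _ (p, p', x, x', e)); rewrite ?leq_max ?leqnn ?orbT //=.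
by rewrite ps p's xs x's es pp' xp xp' !eqxx.
Qed.

(** * Rewriting words along a walk *)

Section Words.
Variable k : nat.
Hypothesis k_diag :
  forall e e' : node, supp e.2 -> supp e'.2 -> chain pairQ k ((e, e), (e', e')) 1.
Hypothesis k_x : forall z z' x v, supp x -> supp v ->
  chain pairQ k (((z, x), (z', x)), ((z, v), (z', v))) 1.
Hypothesis k_move : forall p p' x x' e, supp p -> supp p' -> supp x -> supp x' ->
  py p = py p' -> px p = px x -> px p' = px x' -> supp e.2 ->
  chain pairQ k (((pz p, x), (pz p', x')), (e, e)) ((T p / T x) / (T p' / T x')).

(* The pairs of a ladder ((a, c), (a', c')) are regrouped by sign: a, c' are the inputs and c, a' the
   outputs, in this order. *)
Definition opQ (v : word node 0 * word node 0) t :=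
  chain pairQ k ((v.1.1, v.2.1), (thead v.2.2, thead v.1.2)) t.

Lemma nd_op : nd (@wires4 _ _) opQ.
Proof.
pose m (v : (node * node) * (node * node)) : word node 0 * word node 0 :=
  ((v.1.1, [tuple v.2.2]), (v.1.2, [tuple v.2.1])).
apply: (nd_map (m := m) (pi := fun i => (i.1 == i.2, i.1)) _ _ (nd_chain k nd_pair)).
  by move=> [[] []] //= a a' /(congr1 val) [].
move=> [[a s] [b u]] t opt; eexists; first exact: opt.
rewrite /m /=; congr (_, _, (_, _)); apply: val_inj => /=.
  by case: s {opt} => [[|c [|]]].
by case: u {opt} => [[|c [|]]].
Qed.

Let good (e : node) := supp e.2.

Lemma rewrites0 a b c d t : chain pairQ k ((a, c), (d, b)) t ->
  rewrites opQ 0 [:: a; b] [:: c; d] t.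
Proof. by move=> ab; exists (a, [tuple b]), (c, [tuple d]). Qed.

Lemma op_id u : all good u -> size u = 2 -> rewrites opQ 0 u u 1.
Proof.
case: u => [|a [|b [|]]] //= /and3P[ag bg _] _.
exact/rewrites0/k_diag.
Qed.

Lemma rewrites_refl s u : all good u -> size u = (width s).+1 -> rewrites opQ s u u 1.
Proof. by apply: rewrites_id; apply: op_id. Qed.

(** Input and output word become one wire each; the dummy middle letter gives the shape that [chain]
    expects, gluing along outputs. *)
Definition finQ s (v : word node s * unit * word node s) t := splice opQ (v.1.1, v.2) t.

Lemma nd_fin s : nd (@wires3 _ _ _) (@finQ s).
Proof.
apply: (nd_map (m := fun v => (v.1, tt, v.2))
  (pi := fun i => if i.1 then Some true else None) _ _ (nd_splice s nd_op)).
  by move=> [[] []] //= a a' ->.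
by move=> [[a []] b] t ab; exists (a, b).
Qed.

Lemma finQ_neq0 s v t : @finQ s v t -> t != 0.
Proof. by move=> /(nd_norm (nd_fin s)) t1; rewrite -normr_eq0 t1 oner_eq0. Qed.

Definition word_linked s (u v : seq node) t := exists a b : word node s,
  [/\ u = a.1 :: a.2, v = b.1 :: b.2 & linked (@finQ s) (a, tt) (b, tt) t].

Lemma word_linkedP s u v t : all good v -> size v = (width s).+1 ->
  rewrites opQ s u v t -> word_linked s u v t.
Proof.
move=> vg vs [a [b [ua vb ab]]]; exists a, b; split=> //.
have [b1 [b2 [vb1 vb2 bb]]] := rewrites_refl vg vs.
have e1 : b1 = b.
  by move: vb1; rewrite vb; case: b1 b {vb ab bb} => [x y] [x' y'] /= [-> /val_inj ->].
have e2 : b2 = b.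
  by move: vb2; rewrite vb; case: b2 b {vb ab bb vb1 e1} => [x y] [x' y'] /= [-> /val_inj ->].
rewrite -[t]divr1; apply: (linked_shared (d := b)); first exact: ab.
by move: bb; rewrite e1 e2.
Qed.

Lemma word_linked_refl s v : all good v -> size v = (width s).+1 -> word_linked s v v 1.
Proof. by move=> vg vs; apply: word_linkedP => //; apply: rewrites_refl. Qed.

Lemma cons_tuple_inj n (a b : node * n.-tuple node) :
  a.1 :: a.2 = b.1 :: b.2 -> a = b.
Proof. by case: a b => [x y] [x' y'] /= [-> /val_inj ->]. Qed.

Lemma word_linked_trans s u v w t t' :
  word_linked s u v t -> word_linked s v w t' -> word_linked s u w (t * t').
Proof.
move=> [a [b [ua vb ab]]] [b' [c [vb' wc bc]]]; exists a, c; split=> //.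
have eb : b = b' by apply: cons_tuple_inj; rewrite -vb.
by rewrite -eb in bc; apply: linked_trans ab bc; apply: finQ_neq0.
Qed.

Lemma word_linked_closed s u t : word_linked s u u t -> t = 1.
Proof.
move=> [a [b [ua ub ab]]]; have eb : b = a by apply: cons_tuple_inj; rewrite -ub.
by rewrite eb in ab; apply: linked_closed ab; [apply: finQ_neq0 | apply: nd_fin].
Qed.

Variable o : point.
Hypothesis o_supp : supp o.

(** Only the head carries the current point of the walk; the other nodes store z-letters at the
    placeholder [o]. *)
Definition state x (zs : seq Z) : seq node :=
  if zs is z :: zs' then (z, x) :: [seq (z, o) | z <- zs'] else [::].

Lemma all_state x zs : supp x -> all good (state x zs).
Proof. by case: zs => //= z zs xs; rewrite /good xs all_map; apply/allP. Qed.

Lemma size_state x zs : size (state x zs) = size zs.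
Proof. by case: zs => //= z zs; rewrite size_map. Qed.

Lemma state_perm s x zs zs' : supp x -> size zs = (width s).+1 -> perm_eq zs zs' ->
  word_linked s (state x zs) (state x zs') 1.
Proof.
move=> xs; move=> sz zszs'.
pose R zs zs' := size zs = size zs' /\
  (size zs = (width s).+1 -> word_linked s (state x zs) (state x zs') 1).
suff [_] : R zs zs' by apply.
apply: perm_eq_closure zszs' => {zs zs' sz} [zs|zs1 zs2 zs3 [s12 R12] [s23 R23]|a b u v].
- by split=> // sz; apply: word_linked_refl; rewrite ?all_state ?size_state.
- split=> [|sz]; first by rewrite s12.
  by rewrite -[1]mulr1; apply: word_linked_trans (R12 sz) (R23 _); rewrite -s12.
have suv (c d : Z) : size (c :: u ++ d :: v) = (size u + size v).+2.
  by rewrite /= size_cat /= addnS.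
split=> [|sz]; first by rewrite !suv.
apply: word_linkedP; rewrite ?all_state ?size_state ?suv -?(suv a b) //=.
rewrite !map_cat /=.
apply: (@rewrites_exchange _ _ _ good s (fun a c => ((c.1, a.2), (a.1, c.2)))
  op_id _ _ _ (a, x) (b, o)) => //.
- by move=> [z p] [z' p'].
- by move=> [z p] [z' p'] pg p'g; apply/rewrites0/k_x.
- by apply/allP => e /mapP [z _ ->].
- by apply/allP => e /mapP [z _ ->].
by rewrite !size_map; apply/succn_inj; rewrite -(suv a b).
Qed.

Lemma state_move s p p' x x' zs : supp p -> supp p' -> supp x -> supp x' ->
  py p = py p' -> px p = px x -> px p' = px x' -> size zs = width s ->
  word_linked s (state x (pz p :: zs)) (state x' (pz p' :: zs)) ((T p / T x) / (T p' / T x')).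
Proof.
move=> ps p's xs x's pp' xp xp' sz.
apply: word_linkedP; rewrite ?all_state ?size_state /= ?sz //.
apply: (rewrites_head (good := good)) => //; rewrite ?size_map //.
- exact: op_id.
- by move=> [|e [|]] //= /andP[eg _] _; apply/rewrites0/k_move.
by apply/allP => e /mapP [z _ ->].
Qed.

(* The letter x is represented in a node by the point d x; the resulting factors T (d x) telescope. *)
Variable d : X -> point.
Hypothesis d_supp : forall x, supp (d x).
Hypothesis d_x : forall x, px (d x) = x.

(** The word stores the z-letters to be consumed. Each step trades the head letter, then the
    produced letter is permuted behind those still waiting. *)
Lemma walk_linked s ms x x' zs : walk x ms x' -> (size ms + size zs)%N = (width s).+1 ->
  word_linked s (state (d x) ([seq pz m.1 | m <- ms] ++ zs))
    (state (d x') ([seq pz m.2 | m <- ms] ++ zs)) (walk_val ms * (T (d x') / T (d x))).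
Proof.
elim: ms x zs => [|[p p'] ms IH] x zs.
  move=> /eqP <- sz; rewrite /walk_val big_nil mul1r T_div //.
  by apply: word_linked_refl; rewrite ?all_state ?size_state.
move=> /and5P[/= ps p's /eqP pp' /eqP xp wms] [sz].
rewrite [X in word_linked _ _ _ X](_ : _ =
  (T p / T (d x)) / (T p' / T (d (px p'))) *
  (1 * ((walk_val ms * (T (d x') / T (d (px p')))) * 1))); last first.
  by rewrite /walk_val big_cons /=; field; rewrite !T_neq0.
apply: word_linked_trans.
  apply: (state_move (p := p) (p' := p') (x := d x) (x' := d (px p'))); rewrite ?d_x //.
  by rewrite size_cat size_map.
have szs (f : point * point -> point) :
    size ([seq pz (f m) | m <- ms] ++ pz p' :: zs) = (width s).+1.
  by rewrite size_cat size_map /= addnS sz.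
apply: word_linked_trans.
  apply: (@state_perm _ _ _ ([seq pz m.1 | m <- ms] ++ pz p' :: zs)) => //.
    by rewrite /= size_cat size_map sz.
  by rewrite perm_sym (perm_catCA _ [:: pz p']).
apply: word_linked_trans.
  by apply: IH => //; rewrite /= addnS sz.
apply: (@state_perm _ _ _ (pz p' :: ([seq pz m.2 | m <- ms] ++ zs))) => //.
by rewrite (perm_catCA [seq pz m.2 | m <- ms] [:: pz p'] zs).
Qed.

Lemma walk_val_closed ms x : walk x ms x ->
  perm_eq [seq pz m.1 | m <- ms] [seq pz m.2 | m <- ms] -> walk_val ms = 1.
Proof.
(* Since 2^s is at least s, this level has room for the walk; [zs] pads the word. *)
move=> wms pms; pose s := size ms; have sw : (size ms < (width s).+1)%N.
  rewrite ltnS /s; elim: (size ms) => //= n IH.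
  have w0 : (0 < width n)%N by elim: (n) => //= j j0; rewrite addn_gt0 j0.
  by rewrite -addn1 leq_add.
pose zs := nseq ((width s).+1 - size ms) (pz o).
have sz : (size ms + size zs)%N = (width s).+1 by rewrite size_nseq subnKC // ltnW.
have := walk_linked wms sz; rewrite T_div // mulr1 => /word_linked_trans wt.
rewrite -[LHS]mulr1; apply: (@word_linked_closed s); apply: wt.
apply: state_perm; rewrite ?size_cat ?size_map ?sz //.
by rewrite perm_cat2r perm_sym.
Qed.

End Words.
End Ladders.

Lemma closed_walk_val ms x : walk x ms x ->
  perm_eq [seq pz m.1 | m <- ms] [seq pz m.2 | m <- ms] -> walk_val ms = 1.
Proof.
move=> wms pms; have [r rP] := reach_all; have [k [k1 k2 k3]] := ladder_height rP.
(* The default [o] is never taken, as every x-letter occurs in the support. *)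
have [o os _] := x_onto x; pose d x := odflt o [pick p | supp p && (px p == x)].
have dP y : supp (d y) /\ px (d y) = y.
  rewrite /d; case: pickP => [p /andP[ps /eqP]|] //.
  by have [p ps py_] := x_onto y => /(_ p); rewrite ps py_ eqxx.
by apply: (walk_val_closed k1 k2 k3 os (d := d) _ _ wms pms) => y; case: (dP y).
Qed.

(** * From balanced walks to an embedding *)

Definition step_back (ms : seq (point * point)) := rev [seq (m.2, m.1) | m <- ms].

Lemma walk_cat x x' x'' ms ms' : walk x ms x' -> walk x' ms' x'' -> walk x (ms ++ ms') x''.
Proof.
elim: ms x => [|m ms IH] x /=; first by move=> /eqP ->.
by move=> /and5P[-> -> -> -> /IH h] /h.
Qed.

Lemma walk_back x x' ms : walk x ms x' -> walk x' (step_back ms) x.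
Proof.
elim: ms x => [|m ms IH] x /=; first by rewrite eq_sym.
move=> /and5P[m1 m2 m12 /eqP <- /IH h]; rewrite /step_back /= rev_cons -cats1.
by apply: walk_cat h _; rewrite /= m1 m2 eq_sym m12 !eqxx.
Qed.

Lemma walk_exists x x' : exists ms, walk x ms x'.
Proof.
move: x x'; apply: conn_yx => [x|x x' x'' [ms h] [ms' h']|p q ps qs pq].
- by exists [::]; rewrite /= eqxx.
- by exists (ms ++ ms'); apply: walk_cat h h'.
by exists [:: (p, q)]; rewrite /= ps qs pq !eqxx.
Qed.

Lemma walk_valid x x' ms m : walk x ms x' -> m \in ms -> supp m.1 && supp m.2.
Proof.
elim: ms x => //= m' ms IH x /and5P[m1 m2 _ _ /IH h].
by rewrite inE => /predU1P[->|/h]; rewrite ?m1.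
Qed.

Lemma walk_val_norm x x' ms : walk x ms x' -> `|walk_val ms| = 1.
Proof.
move=> wms; rewrite /walk_val normr_prod big_seq big1 // => m mms.
have /andP[m1 m2] := walk_valid wms mms.
by rewrite normrM normfV !(nd_norm ndQ (conj _ erefl)) // divr1.
Qed.

Definition content (ms : seq (point * point)) : {ffun Z -> int} :=
  [ffun z => \sum_(m <- ms) ((pz m.1 == z)%:Z - (pz m.2 == z)%:Z)].

Lemma content_cat ms ms' : content (ms ++ ms') = content ms + content ms'.
Proof. by apply/ffunP => z; rewrite !ffunE big_cat. Qed.

Lemma content_back ms : content (step_back ms) = - content ms.
Proof.
apply/ffunP => z; rewrite !ffunE /step_back big_rev big_map -sumrN.
by apply: eq_bigr => m _; rewrite opprB.
Qed.

Lemma content_perm ms : content ms = 0 ->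
  perm_eq [seq pz m.1 | m <- ms] [seq pz m.2 | m <- ms].
Proof.
move=> /ffunP ms0; apply/allP => z _; apply/eqP.
have := ms0 z; rewrite !ffunE sumrB => /eqP; rewrite subr_eq0 => /eqP e.
rewrite -!sum1_count !big_map ![in LHS]big_mkcond ![in RHS]big_mkcond /=.
have toZ (f : point * point -> bool) :
    \sum_(m <- ms) (f m)%:Z = (\sum_(m <- ms) (if f m then 1 else 0))%N%:Z.
  by elim: (ms) => [|m l IH]; rewrite ?big_nil // !big_cons IH; case: (f m).
by move: e; rewrite !toZ => -[].
Qed.

Lemma walk_val_cat ms ms' : walk_val (ms ++ ms') = walk_val ms * walk_val ms'.
Proof. by rewrite /walk_val big_cat. Qed.

Lemma walk_val_back ms : walk_val (step_back ms) = (walk_val ms)^-1.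
Proof.
rewrite /walk_val /step_back big_rev big_map -prodfV.
by apply: eq_bigr => m _; rewrite invf_div.
Qed.

Lemma chi_content1 (c : Z -> L) p q : (forall z, c z != 0) ->
  chi c (content [:: (p, q)]) = c (pz p) / c (pz q).
Proof.
move=> c0; have e1 z : chi c [ffun u => (z == u)%:Z] = c z.
  rewrite /chi (bigD1 z) //= ffunE eqxx expr1z big1 ?mulr1 // => u uz.
  by rewrite ffunE eq_sym (negbTE uz) expr0z.
rewrite -[c (pz p)]e1 -[c (pz q)]e1 -chiB //; congr chi.
by apply/ffunP => z; rewrite !ffunE big_seq1.
Qed.

Lemma embedding : exists (f : X -> L) (g : Y -> L) (h : Z -> L),
  [/\ forall x, `|f x| = 1, forall y, `|g y| = 1, forall z, `|h z| = 1 &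
  forall p, supp p -> f (px p) * g (py p) * h (pz p) * T p = 1].
Proof.
case: (pickP supp) => [p0 p0s|nosupp]; last first.
  by exists (fun _ => 1), (fun _ => 1), (fun _ => 1); split=> [x|y|z|p]; rewrite ?normr1 ?nosupp.
pose x0 := px p0.
(* Closed walks at [x0] are concatenated and reversed, so contents with values form the graph of a
   homomorphism. *)
have [|||c [c1 cP]] := @extend_character L Z
  (fun v t => exists ms, [/\ walk x0 ms x0, content ms = v & walk_val ms = t]).
- move=> v w t u [ms [wms <- <-]] [ms' [wms' <- <-]].
  exists (ms ++ step_back ms'); split; first exact: walk_cat wms (walk_back wms').
    by rewrite content_cat content_back.
  by rewrite walk_val_cat walk_val_back.
- by move=> t [ms [wms /content_perm pms <-]]; apply: (closed_walk_val wms pms).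
- by move=> v t [ms [wms _ <-]]; apply: walk_val_norm wms.
have c0 z : c z != 0 by rewrite -normr_eq0 c1 oner_eq0.
pose way x := xchoose (walk_exists x0 x).
have wayP x : walk x0 (way x) x by exact: (xchooseP (walk_exists x0 x)).
(* With the character of the content divided out, the value of a walk depends on its endpoint
   only. *)
pose f x := walk_val (way x) / chi c (content (way x)).
have f1 x : `|f x| = 1.
  by rewrite /f normrM normfV (walk_val_norm (wayP x)) chi_norm // divr1.
pose b p := f (px p) * (T p / c (pz p)).
have b1 p : supp p -> `|b p| = 1.
  by move=> ps; rewrite /b normrM f1 mul1r normrM normfV c1 (nd_norm ndQ (conj ps erefl)) divr1.
have bE p q : supp p -> supp q -> py p = py q -> b p = b q.
  move=> ps qs pq.
  (* Go to the x-letter of [p], step from [p] to [q], and return: a closed walk comparing [b p] with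
     [b q]. *)
  pose ms := way (px p) ++ [:: (p, q)] ++ step_back (way (px q)).
  have wms : walk x0 ms x0.
    apply: walk_cat (wayP _) _; apply: (walk_cat (x' := px q)); last exact/walk_back.
    by rewrite /= ps qs pq !eqxx.
  have := cP _ _ (ex_intro _ ms (And3 wms erefl erefl)).
  rewrite /ms !content_cat !walk_val_cat content_back walk_val_back addrA chiB //.
  rewrite -[content [:: _]]opprK chiB // -[- content [:: _]]sub0r chiB // chi0.
  rewrite chi_content1 // [walk_val [:: _]]big_seq1 /= /b /f.
  have nz x : walk_val (way x) != 0 by rewrite -normr_eq0 (walk_val_norm (wayP x)) oner_eq0.
  have nzc x : chi c (content (way x)) != 0 by rewrite -normr_eq0 chi_norm ?oner_eq0.
  set vp := walk_val _; set vq := walk_val (way (px q)).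
  set kp := chi c (content (way (px p))); set kq := chi c (content (way (px q))) => e.
  transitivity (vp * (T p / T q / vq) * (vq / kp * (T q / c (pz p)))).
    by field; rewrite ?c0 ?T_neq0 ?nz ?nzc.
  by rewrite e; field; rewrite ?c0 ?T_neq0 ?nz ?nzc.
pose g y := if [pick p | supp p && (py p == y)] is Some p then (b p)^-1 else 1.
exists f, g, (fun z => (c z)^-1); split=> // [y|z|p ps].
- by rewrite /g; case: pickP => [p /andP[ps _]|_]; rewrite ?normr1 // normfV b1 ?invr1.
- by rewrite normfV c1 invr1.
rewrite /g; case: pickP => [q /andP[qs /eqP qp]|/(_ p)]; last by rewrite ps eqxx.
rewrite (bE q p) // /b; have fx0 : f (px p) != 0 by rewrite -normr_eq0 f1 oner_eq0.
by field; rewrite fx0 c0 T_neq0.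
Qed.

End Paths.

Local Open Scope complex_scope.

Lemma connect_closed (V : finType) (e : rel V) (K : V -> Prop) u v :
  (forall x y, e x y -> K x -> K y) -> connect e u v -> K u -> K v.
Proof.
move=> eK /connectP [p + ->]; elim: p u => //= x p IH u /andP[ux xp] Ku.
exact: IH xp (eK _ _ ux Ku).
Qed.

(** * Proof of the theorem *)

Section Bipartite.
Variables (A B : finType) (adj : A -> B -> bool).
Hypothesis conn : bip_connected adj.

Lemma bip_connected_right (R : B -> B -> Prop) : (forall b, R b b) ->
  (forall b1 b2 b3, R b1 b2 -> R b2 b3 -> R b1 b3) ->
  (forall a b b', adj a b -> adj a b' -> R b b') -> forall b b', R b b'.
Proof.
move=> Rr Rt Ra b b'.
(* At a left vertex the invariant is that [R] holds from [b] to all its neighbours. *)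
apply: (connect_closed (K := fun u => match u with
  | inr c => R b c | inl a => forall c, adj a c -> R b c end) _ (conn (inr b) (inr b'))) => //.
move=> [a|c] [a'|c'] //= ac; first exact.
by move=> bc c' ac'; apply: Rt bc (Ra _ _ _ ac ac').
Qed.

Lemma bip_connected_left (R : A -> A -> Prop) : (forall a, R a a) ->
  (forall a1 a2 a3, R a1 a2 -> R a2 a3 -> R a1 a3) ->
  (forall b a a', adj a b -> adj a' b -> R a a') -> forall a a', R a a'.
Proof.
move=> Rr Rt Rb a a'.
apply: (connect_closed (K := fun u => match u with
  | inl c => R a c | inr b => forall c, adj c b -> R a c end) _ (conn (inl a) (inl a'))) => //.
move=> [c|b] [c'|b'] //= ac; last exact.
by move=> bc d ac'; apply: Rt bc (Rb _ _ _ ac ac').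
Qed.

(** A path from [a] to the other side has a first edge. *)
Lemma bip_connected_nbr_left : B -> forall a, exists b, adj a b.
Proof.
move=> b a.
apply: (connect_closed (K := fun u => match u with
  | inl c => c = a \/ exists b, adj a b | inr _ => exists b, adj a b end)
  _ (conn (inl a) (inr b))) => [|]; last by left.
move=> [c|d] [c'|d'] //= ac; last by right.
by case=> [<-|//]; exists d'.
Qed.

Lemma bip_connected_nbr_right : A -> forall b, exists a, adj a b.
Proof.
move=> a b.
apply: (connect_closed (K := fun u => match u with
  | inr c => c = b \/ exists a, adj a b | inl _ => exists a, adj a b end)
  _ (conn (inr b) (inl a))) => [|]; last by left.
move=> [c|d] [c'|d'] //= ac; first by right.
by case=> [<-|//]; exists c'.
Qed.

End Bipartite.

(** * The correlation as a sum over words of points *)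

Section CorrelationSum.
Variables (R : realType) (S G P : finType).
Variables (mu : S -> G -> P -> R) (T : S -> G -> P -> R[i]).
Let point := (S * G * P)%type.
Let m (p : point) : R[i] := (mu p.1.1 p.1.2 p.2)%:C.
Let t (p : point) : R[i] := T p.1.1 p.1.2 p.2.

Lemma corrE n (F : {ffun 'I_n -> S} -> R[i]) (Gf : {ffun 'I_n -> G} -> R[i])
    (H : {ffun 'I_n -> P} -> R[i]) :
  corr mu T F Gf H = \sum_(c : {ffun 'I_n -> point}) (\prod_k (m (c k) * t (c k))) *
    (F [ffun k => (c k).1.1] * Gf [ffun k => (c k).1.2] * H [ffun k => (c k).2]).
Proof.
pose pr (w : {ffun 'I_n -> S} * {ffun 'I_n -> G} * {ffun 'I_n -> P}) : {ffun 'I_n -> point} :=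
  [ffun k => (w.1.1 k, w.1.2 k, w.2 k)].
rewrite (reindex pr) /=; last first.
  exists (fun c : {ffun 'I_n -> point} =>
    ([ffun k => (c k).1.1], [ffun k => (c k).1.2], [ffun k => (c k).2])) => [[[a b] c] _|c _].
    by congr (_, _, _); apply/ffunP => k; rewrite !ffunE.
  by apply/ffunP => k; rewrite !ffunE; case: (c k) => [[]].
rewrite /corr pair_bigA /= pair_bigA /=; apply: eq_bigr => -[[a b] c] _ /=.
rewrite (_ : [ffun k => (pr (a, b, c) k).1.1] = a); last by apply/ffunP => k; rewrite !ffunE.
rewrite (_ : [ffun k => (pr (a, b, c) k).1.2] = b); last by apply/ffunP => k; rewrite !ffunE.
rewrite (_ : [ffun k => (pr (a, b, c) k).2] = c); last by apply/ffunP => k; rewrite !ffunE.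
rewrite big_split /= rmorph_prod /=.
rewrite [X in _ = X * _ * _](eq_bigr (fun k => (mu (a k) (b k) (c k))%:C)) => [|k _]; last first.
  by rewrite /m /pr ffunE.
rewrite [X in _ = _ * X * _](eq_bigr (fun k => T (a k) (b k) (c k))) => [|k _]; last first.
  by rewrite /t /pr ffunE.
by ring.
Qed.

End CorrelationSum.

Lemma exp_decay_base2 (R : realType) (r : R[i]) : 0 < r < 1 ->
  exists c : R, 0 < c /\ forall n, r ^+ n = ((2 : R) `^ (- (c * n%:R)))%:C.
Proof.
(* Comparability with 0 makes the rate real; c is minus its base-2 logarithm. *)
case: r => a b; rewrite !ltcE /= => /andP[/andP[/eqP -> a0] /andP[_ a1]].
have ln2 : 0 < ln (2 : R) by rewrite ln_gt0 // ltr1n.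
exists (- ln a / ln 2); split.
  by rewrite divr_gt0 // oppr_gt0 ln_lt0 // a0.
move=> n; rewrite (_ : a +i* 0 = a%:C) // -rmorphXn /=; congr (_%:C).
rewrite /powR pnatr_eq0 /= (_ : _ * ln 2 = n%:R * ln a); last by field; rewrite gt_eqF.
by rewrite expRM_natl lnK // posrE.
Qed.

Theorem theorem2p3 (R : realType) (S G P : finType)
  (mu : S -> G -> P -> R) (T : S -> G -> P -> R[i]) :
  is_distribution mu -> pairwise_connected mu ->
  maps_supp_to_D mu T -> nonembeddable mu T ->
  exists c : R, 0 < c /\
    forall (n : nat) (F : {ffun 'I_n -> S} -> R[i])
      (Gf : {ffun 'I_n -> G} -> R[i]) (H : {ffun 'I_n -> P} -> R[i]),
      (forall x, inD (F x)) -> (forall y, inD (Gf y)) -> (forall z, inD (H z)) ->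
      `|corr mu T F Gf H| <= ((2 : R) `^ (- (c * n%:R)))%:C.
Proof.
move=> [mu0 mu1] [connXY [connYZ connXZ]] TD nonemb.
suff [r [r01 rP]] : exists r : R[i], 0 < r < 1 /\
    forall n (F : {ffun 'I_n -> S} -> R[i]) (Gf : {ffun 'I_n -> G} -> R[i])
      (H : {ffun 'I_n -> P} -> R[i]),
      (forall x, inD (F x)) -> (forall y, inD (Gf y)) -> (forall z, inD (H z)) ->
      `|corr mu T F Gf H| <= r ^+ n.
  have [c [c0 cP]] := exp_decay_base2 r01; exists c; split=> // n F Gf H F1 G1 H1.
  by rewrite -cP; apply: rP.
pose point := (S * G * P)%type.
pose m (p : point) : R[i] := (mu p.1.1 p.1.2 p.2)%:C.
pose t (p : point) : R[i] := T p.1.1 p.1.2 p.2.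
pose supp (p : point) := in_supp mu p.1.1 p.1.2 p.2.
have m0 p : 0 <= m p by rewrite lecR mu0.
have m_gt0 p : (0 < m p) = supp p by rewrite ltcR.
have m1 : \sum_p m p = 1.
  rewrite -rmorph_sum /= -[RHS](rmorph1 (real_complex R)); congr (_%:C).
  by rewrite -mu1 pair_bigA /= pair_bigA.
have m_off p : ~~ supp p -> m p = 0.
  by rewrite -m_gt0 lt_neqAle m0 andbT negbK => /eqP.
have t1 p : supp p -> `|t p| <= 1 by apply: TD.
have [p0 p0s] : exists p, supp p.
  apply/existsP; apply: contraT; rewrite negb_exists => /forallP nos.
  by move: m1; rewrite big1 => [/eqP|p _]; [rewrite eq_sym oner_eq0 | exact: m_off].
have mt p : `|m p * t p| = m p * `|t p| by rewrite normrM (ger0_norm (m0 p)).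
have mt1 p : m p * `|t p| <= m p.
  have [/t1 ?|/m_off ->] := boolP (supp p); last by rewrite mul0r.
  by rewrite ler_piMr.
have [/existsP[p /andP[ps tp]]|] := boolP [exists p, supp p && (`|t p| != 1)].
  pose s := \sum_p m p * `|t p|.
  have s0 : 0 <= s by apply: sumr_ge0 => q _; rewrite mulr_ge0.
  have s1 : s < 1.
    rewrite -m1 /s (bigD1 p) //= [X in _ < X](bigD1 p) //=; apply: ltr_leD.
      by rewrite gtr_pMr ?m_gt0 // lt_neqAle tp t1.
    exact: ler_sum.
  exists ((1 + s) / 2); split.
    rewrite divr_gt0 ?ltr_wpDr ?ltr01 ?ltr0n //= ltr_pdivrMr ?ltr0n // mul1r.
    by rewrite -[2]/(1 + 1) ltrD2l.
  move=> n F Gf H F1 G1 H1; rewrite corrE.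
  apply: le_trans (_ : s ^+ n <= _); last first.
    rewrite lerXn2r ?nnegrE ?divr_ge0 ?addr_ge0 ?ler0n ?ler01 // ler_pdivlMr ?ltr0n //.
    by rewrite mulr_natr mulr2n lerD2r ltW.
  rewrite -[n in s ^+ n]card_ord -prodr_const bigA_distr_bigA /=.
  apply: le_trans (ler_norm_sum _ _ _) _; apply: ler_sum => c _.
  rewrite normrM normr_prod (eq_bigr _ (fun k _ => mt (c k))).
  rewrite ler_piMr ?prodr_ge0 // => [k _|]; first by rewrite mulr_ge0.
  by rewrite !normrM !mulr_ile1 ?mulr_ge0 //; [apply: F1 | apply: G1 | apply: H1].
rewrite negb_exists => /forallP tn1.
have {}t1 p : supp p -> `|t p| = 1.
  by move=> ps; apply/eqP; move: (tn1 p); rewrite ps negbK.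
(* Phases must have norm 1 everywhere; off the support the weight is 0, so the value 1 is
   harmless. *)
pose ph p := if supp p then t p else 1.
have ph1 p : `|ph p| = 1 by rewrite /ph; case: ifP => [/t1|_] //; rewrite normr1.
pose S0 := System m0 m1 ph1.
have [[r [r01 rP]]|nodec] := pselect (decays (S := S0) (@wires3 S G P)).
  exists r; split=> // n F Gf H F1 G1 H1; rewrite corrE.
  pose f (i : option bool) (c : {ffun 'I_n -> point}) := match i with
    | Some true => F [ffun k => (c k).1.1] | Some false => Gf [ffun k => (c k).1.2]
    | None => H [ffun k => (c k).2] end.
  have fE i : local_fun (@wires3 S G P i) (f i).
    case: i => [[]|]; split=> [c|c c' cc']; rewrite /f; try exact: F1; try exact: G1; try exact: H1.
    - by congr F; apply/ffunP => k; rewrite !ffunE; apply: cc'.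
    - by congr Gf; apply/ffunP => k; rewrite !ffunE; apply: cc'.
    - by congr H; apply/ffunP => k; rewrite !ffunE; apply: cc'.
  have := rP n f fE; congr (`|_| <= _); apply: eq_bigr => c _; congr (_ * _).
    apply: eq_bigr => k _ /=; rewrite /ph; case: ifP => // /negbT /m_off mk.
    by rewrite -/(m (c k)) mk !mul0r.
  rewrite (bigD1 (Some true)) //= (bigD1 (Some false)) //= (big_pred1 None) ?mulrA //.
  by move=> [[]|].
(* Without decay, [embedding] yields the forbidden factors. *)
case: nonemb.
have ndQ : nd (@wires3 S G P) (pointQ supp ph).
  by exists S0, id; split=> // p u [ps ->]; exists p; rewrite /= m_gt0.
have adjP (A B : finType) (adj : A -> B -> bool) (f : point -> A) (g : point -> B) :
    (forall a b, adj a b -> exists2 p, supp p & f p = a /\ g p = b) ->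
    bip_connected adj -> connects supp f g.
  move=> adjE conn Q Qr Qt Qs; apply: (bip_connected_right conn) => // a b b'.
  by move=> /adjE [p ps [fp <-]] /adjE [q qs [fq <-]]; apply: Qs => //; rewrite fp.
have adjC (A B : finType) (adj : A -> B -> bool) (f : point -> A) (g : point -> B) :
    (forall a b, adj a b -> exists2 p, supp p & f p = a /\ g p = b) ->
    bip_connected adj -> connects supp g f.
  move=> adjE conn Q Qr Qt Qs; apply: (bip_connected_left conn) => // b a a'.
  by move=> /adjE [p ps [<- gp]] /adjE [q qs [<- gq]]; apply: Qs => //; rewrite gp.
have adjXY x y : [exists z, in_supp mu x y z] -> exists2 p, supp p & p.1.1 = x /\ p.1.2 = y.
  by move=> /existsP [z xyz]; exists (x, y, z).
have adjYZ y z : [exists x, in_supp mu x y z] -> exists2 p, supp p & p.1.2 = y /\ p.2 = z.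
  by move=> /existsP [x xyz]; exists (x, y, z).
have adjXZ x z : [exists y, in_supp mu x y z] -> exists2 p, supp p & p.1.1 = x /\ p.2 = z.
  by move=> /existsP [y xyz]; exists (x, y, z).
have [||||||f [g [h [f1 g1 h1 fghT]]]] := embedding ndQ.
- move=> x; have [z /adjXZ [p ps [px _]]] := bip_connected_nbr_left connXZ p0.2 x.
  by exists p.
- move=> z; have [x /adjXZ [p ps [_ pz]]] := bip_connected_nbr_right connXZ p0.1.1 z.
  by exists p.
- exact: adjP connXZ.
- exact: adjC connXZ.
- exact: adjP connYZ.
- exact: adjC connXY.
exists f, g, h; split; first by move=> x; rewrite /inD f1.
split; first by move=> y; rewrite /inD g1.
split; first by move=> z; rewrite /inD h1.
by move=> x y z xyz; have := fghT (x, y, z) xyz; rewrite /ph /supp /= xyz.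
Qed.
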